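(* Let $\Bbbk$ be a field of characteristic $p>2$ and let $m,n\in\mathbb N$. (i) If $r$ is an integer with $r_p(m,n)<r\le m+n+mn$, then the morphism $\Phi^{(r)}_{m|n}:\Bbbk S_r\to \mathrm{End}_{GL(m|n)}(V_{m|n}^{\otimes r})$ is neither injective nor surjective. (ii) If the morphism $\Phi^{(r)}_{m|n}$ is surjective for all integers $r\ge 1$, then $mn=0$ or $m+n<p$.
   Context: $\mathbb N=\{0,1,2,\dots\}$. $V=V_{m|n}=\Bbbk^{m|n}$ is the super vector space over $\Bbbk$ with even part of dimension $m$ and odd part of dimension $n$. $GL(m|n)$ is the affine group superscheme over $\Bbbk$ sending a supercommutative $\Bbbk$-superalgebra $R$ to the group of parity-preserving $R$-linear automorphisms of $V\otimes R$; it acts diagonally on $V^{\otimes r}$, and $\mathrm{End}_{GL(m|n)}(V^{\otimes r})$ is the algebra of (parity-preserving) $\Bbbk$-linear endomorphisms of $V^{\otimes r}$ commuting with this action. The symmetric group $S_r$ acts on $V^{\otimes r}$ by $$\sigma(v_1\otimes\cdots\otimes v_r)=(-1)^{\langle\sigma;v_1,\dots,v_r\rangle}\,v_{\sigma^{-1}1}\otimes\cdots\otimes v_{\sigma^{-1}r}$$ for homogeneous $v_i$, where $\langle\sigma;v_1,\dots,v_r\rangle=\#\{1\le k<l\le r\mid \sigma k>\sigma l,\ v_k \text{ and } v_l \text{ odd}\}$. This action commutes with $GL(m|n)$ and gives the algebra morphism $\Phi^{(r)}_{m|n}:\Bbbk S_r\to\mathrm{End}_{GL(m|n)}(V^{\otimes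 r})$. The integer $r_p(m,n)$ is the unique integer such that, for all $r\ge1$, $\Phi^{(r)}_{m|n}$ is injective if and only if $r\le r_p(m,n)$, i.e. the largest $r\ge1$ for which $\Phi^{(r)}_{m|n}$ is injective (and $0$ if $m=n=0$). *)

(* Defs.v *)
From HB Require Import structures.
From mathcomp Require Import all_boot all_order all_algebra all_fingroup.

Set Implicit Arguments.
Unset Strict Implicit.
Unset Printing Implicit Defensive.

Import GRing.Theory.
Local Open Scope ring_scope.

(* The standard homogeneous basis of k^{m|n} is indexed by 'I_(m + n), the
   first m vectors being even and the last n odd. *)
Definition odd_index (m n : nat) (i : 'I_(m + n)) : bool := (m <= i)%N.

(* A word w indexes the basis vector v_(w 0) (x) ... (x) v_(w (r - 1)). *)
Definition word (m n r : nat) := {ffun 'I_r -> 'I_(m + n)}.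

Definition odd_word (m n r : nat) (w : word m n r) : bool :=
  odd (\sum_(i < r) odd_index (w i))%N.

(* V_{m|n}^{(x) r}, as the free k-module on words. *)
Definition tens (k : fieldType) (m n r : nat) := {ffun word m n r -> k^o}.

Definition basis_tens (k : fieldType) (m n r : nat) (w : word m n r) :
  tens k m n r := [ffun u => (u == w)%:R].

Definition homogeneous (k : fieldType) (m n r : nat) (b : bool)
    (t : tens k m n r) : Prop :=
  forall w, t w != 0 -> odd_word w = b.

Definition parity_preserving (k : fieldType) (m n r : nat)
    (f : 'End(tens k m n r)) : Prop :=
  forall b t, homogeneous b t -> homogeneous b (f t).

(* A Z/2-graded supercommutative k-algebra; [sa_hom false] and [sa_hom true] are
   the even and odd parts.  The extra condition that odd elements square to zero,
   needed in characteristic 2, is automatic in all other characteristics.  An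
   algType is nonzero; over the zero algebra GL(m|n) is trivial. *)
Record superAlgebra (k : fieldType) := SuperAlgebra {
  sa_car :> algType k;
  sa_hom : bool -> sa_car -> Prop;
  sa_hom0 : forall b, sa_hom b 0;
  sa_homP : forall b (c : k) x y,
    sa_hom b x -> sa_hom b y -> sa_hom b (c *: x + y);
  sa_decomp : forall x, exists x0 x1,
    [/\ sa_hom false x0, sa_hom true x1 & x = x0 + x1];
  sa_direct : forall x, sa_hom false x -> sa_hom true x -> x = 0;
  sa_hom1 : sa_hom false 1;
  sa_homM : forall a b x y,
    sa_hom a x -> sa_hom b y -> sa_hom (a (+) b) (x * y);
  sa_supercomm : forall a b x y,
    sa_hom a x -> sa_hom b y -> x * y = (-1) ^+ (a && b) * (y * x)
}.

(* The R-points of GL(m|n).  V (x) R is the free right R-module of column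
   vectors; as R is supercommutative, a parity-preserving map is left R-linear
   iff it is right R-linear, and such maps are the matrices whose (i, j) entry
   has parity |i| + |j|. *)
Definition in_GL (k : fieldType) (m n : nat) (R : superAlgebra k)
    (g : 'M[R]_(m + n)) : Prop :=
  (forall i j, sa_hom (odd_index i (+) odd_index j) (g i j)) /\
  (exists h : 'M[R]_(m + n), g *m h = 1%:M /\ h *m g = 1%:M).

(* V^{(x) r} (x) R *)
Definition tensR (k : fieldType) (m n r : nat) (R : superAlgebra k) :=
  {ffun word m n r -> R}.

(* The coefficient of v_u in g v_(w 0) (x)_R ... (x)_R g v_(w (r - 1)), where
   g v_j = \sum_i v_i g_ij.  The sign comes from moving each g_(u a)(w a), of
   parity |u a| + |w a|, to the right past the v_(u b) with a < b. *)
Definition GL_coef (k : fieldType) (m n r : nat) (R : superAlgebra k)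
    (g : 'M[R]_(m + n)) (u w : word m n r) : R :=
  (-1) ^+ (\sum_(a < r) \sum_(b < r | (a < b)%N)
             ((odd_index (u a) (+) odd_index (w a)) && odd_index (u b)))%N
  * \prod_(a < r) g (u a) (w a).

Definition GL_act (k : fieldType) (m n r : nat) (R : superAlgebra k)
    (g : 'M[R]_(m + n)) (t : tensR m n r R) : tensR m n r R :=
  [ffun u => \sum_w GL_coef g u w * t w].

(* f (x) id_R *)
Definition extend_scalars (k : fieldType) (m n r : nat) (R : superAlgebra k)
    (f : 'End(tens k m n r)) (t : tensR m n r R) : tensR m n r R :=
  [ffun u => \sum_w (f (basis_tens k w) u : k) *: t w].

Definition End_GL (k : fieldType) (m n r : nat) (f : 'End(tens k m n r)) :
    Prop :=
  parity_preserving f /\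
  forall (R : superAlgebra k) (g : 'M[R]_(m + n)), in_GL g ->
    forall t : tensR m n r R,
      extend_scalars f (GL_act g t) = GL_act g (extend_scalars f t).

(* <sigma; v_(w 0), ..., v_(w (r - 1))> *)
Definition odd_inversions (m n r : nat) (s : 'S_r) (w : word m n r) : nat :=
  #|[set ab : 'I_r * 'I_r | [&& (ab.1 < ab.2)%N, (s ab.2 < s ab.1)%N,
       odd_index (w ab.1) & odd_index (w ab.2)]]|.

Definition perm_word (m n r : nat) (s : 'S_r) (w : word m n r) : word m n r :=
  [ffun i => w ((s^-1)%g i)].

Definition perm_tens (k : fieldType) (m n r : nat) (s : 'S_r)
    (t : tens k m n r) : tens k m n r :=
  \sum_w ((-1) ^+ odd_inversions s w * t w) *: basis_tens k (perm_word s w).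

Fact perm_tens_is_linear (k : fieldType) (m n r : nat) (s : 'S_r) :
  linear (@perm_tens k m n r s).
Proof.
move=> c t t'; rewrite /perm_tens scaler_sumr -big_split /=.
apply: eq_bigr => w _; rewrite !ffunE scalerA -scalerDl mulrDr.
by rewrite /GRing.scale /= mulrCA.
Qed.

HB.instance Definition _ (k : fieldType) (m n r : nat) (s : 'S_r) :=
  GRing.isLinear.Build k (tens k m n r) (tens k m n r) _ (perm_tens s)
    (perm_tens_is_linear s).

(* The vector space underlying the group algebra: [a] stands for
   \sum_s a s s.  The product of k S_r plays no role in the injectivity or
   surjectivity of Phi, and is not introduced. *)
Definition group_algebra (k : fieldType) (r : nat) := {ffun 'S_r -> k^o}.

Definition Phi_fun (k : fieldType) (m n r : nat) (a : group_algebra k r) :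
  'End(tens k m n r) := \sum_s (a s : k) *: linfun (perm_tens s).

Fact Phi_is_linear (k : fieldType) (m n r : nat) : linear (@Phi_fun k m n r).
Proof.
move=> c a b; rewrite /Phi_fun scaler_sumr -big_split /=.
by apply: eq_bigr => s _; rewrite !ffunE scalerA -scalerDl.
Qed.

HB.instance Definition _ (k : fieldType) (m n r : nat) :=
  GRing.isLinear.Build k (group_algebra k r) 'End(tens k m n r) _
    (@Phi_fun k m n r) (@Phi_is_linear k m n r).

Definition Phi (k : fieldType) (m n r : nat) :
  'Hom(group_algebra k r, 'End(tens k m n r)) := linfun (@Phi_fun k m n r).

(* Surjectivity onto End_GL(V^{(x) r}), which contains the image of Phi. *)
Definition Phi_surjective (k : fieldType) (m n r : nat) : Prop :=
  forall f : 'End(tens k m n r), End_GL f -> exists a, Phi k m n r a = f.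

Lemma expn_lt_fact (D r : nat) : (2 * D ^ 2 < r)%N -> (D ^ r < r`!)%N.
Proof.
have H q j : (q.+1 ^ j * q`! <= (q + j)`!)%N.
  elim: j => [|j IHj]; first by rewrite mul1n addn0.
  rewrite addnS factS expnS -mulnA; apply: leq_mul => //.
  by rewrite ltnS leq_addr.
case: D => [|D] ltr.
  by rewrite exp0n ?fact_gt0 //; case: r ltr.
have := odd_double_half r; set q := r./2 => def_r.
have leq_q : (D.+1 ^ 2 <= q)%N.
  rewrite -(leq_pmul2l (isT : (0 < 2)%N)) mul2n -ltnS.
  move: ltr; rewrite -{1}def_r -mul2n; case: (odd r); rewrite ?add1n ?add0n //.
    by rewrite mul2n.
  by rewrite mul2n => /ltnW; rewrite ltnS.
have lt_sq : (D.+1 ^ (q.*2) < (q.*2)`!)%N.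
  rewrite -mul2n expnM mul2n -addnn.
  apply: leq_trans (H q q); apply: (@leq_trans (q.+1 ^ q)%N).
    rewrite ltn_exp2r ?ltnS //.
    by apply: leq_trans leq_q; rewrite expn_gt0.
  by rewrite leq_pmulr // fact_gt0.
rewrite -def_r; case: (odd r); rewrite ?add1n ?add0n // expnS factS.
apply: ltn_mul => //; rewrite ltnS -addnn.
apply: leq_trans (leq_addr _ _); apply: leq_trans leq_q.
by rewrite expnS expn1 leq_pmull.
Qed.

Lemma Phi_injective_bound (k : fieldType) (m n r : nat) :
  (lker (Phi k m n r) == 0%VS) -> (r <= 2 * ((m + n) ^ 2) ^ 2)%N.
Proof.
move=> /eqP ker0; rewrite leqNgt; apply/negP => /expn_lt_fact.
rewrite ltnNge => /negP[].
have /limg_dim_eq dimE : (fullv :&: lker (Phi k m n r) = 0)%VS.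
  by rewrite ker0 capv0.
have dimT : dim (tens k m n r) = ((m + n) ^ r)%N.
  change ((#|{: word m n r}| * 1)%N = ((m + n) ^ r)%N).
  by rewrite muln1 card_ffun !card_ord.
have dimS : dim (group_algebra k r) = r`!.
  change ((#|{: 'S_r}| * 1)%N = r`!); by rewrite muln1 card_Sn.
have := dimvS (subvf (limg (Phi k m n r))); rewrite dimE !dimvf dimS.
have -> : dim 'End(tens k m n r) = (((m + n) ^ r) * ((m + n) ^ r))%N.
  by rewrite -dimT.
by rewrite mulnn -!expnM mulnC.
Qed.

Lemma PhiE (k : fieldType) (m n r : nat) (a : group_algebra k r)
    (t : tens k m n r) :
  Phi k m n r a t = \sum_s (a s : k) *: perm_tens s t.
Proof.
rewrite lfunE /= /Phi_fun sum_lfunE; apply: eq_bigr => s _.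
by rewrite scale_lfunE lfunE.
Qed.

Lemma perm_tens_basis (k : fieldType) (m n r : nat) (s : 'S_r)
    (w : word m n r) :
  perm_tens s (basis_tens k w) =
    (-1) ^+ odd_inversions s w *: basis_tens k (perm_word s w).
Proof.
rewrite /perm_tens (bigD1 w) //= ffunE eqxx mulr1 big1 ?addr0 // => u neq_uw.
by rewrite ffunE (negPf neq_uw) mulr0 scale0r.
Qed.

Lemma tens_basisE (k : fieldType) (m n r : nat) (t : tens k m n r) :
  t = \sum_w (t w : k) *: basis_tens k w.
Proof.
apply/ffunP => u; rewrite sum_ffunE (bigD1 u) //= !ffunE eqxx big1.
  by rewrite addr0 /GRing.scale /= mulr1.
by move=> w neq_wu; rewrite !ffunE eq_sym (negPf neq_wu) scaler0.
Qed.

Lemma Phi0P (k : fieldType) (m n r : nat) (a : group_algebra k r) :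
  (Phi k m n r a = 0) <->
  (forall w u : word m n r,
     \sum_s (a s : k) * ((-1) ^+ odd_inversions s w * (u == perm_word s w)%:R)
       = 0 :> k).
Proof.
have H s w u : ((a s : k) *: perm_tens s (basis_tens k w) : tens k m n r) u =
    (a s : k) * ((-1) ^+ odd_inversions s w * (u == perm_word s w)%:R) :> k.
  by rewrite perm_tens_basis !ffunE.
have E w u : (Phi k m n r a (basis_tens k w)) u =
    \sum_s (a s : k) * ((-1) ^+ odd_inversions s w * (u == perm_word s w)%:R)
    :> k.
  rewrite PhiE sum_ffunE.
  exact: (@eq_bigr k 0 +%R _ _ _ _ _ (fun s _ => H s w u)).
split=> [a0 w u | a0]; first by rewrite -E a0 lfunE /= ffunE.
apply/lfunP => t; rewrite [RHS]lfunE /= [t]tens_basisE linear_sum big1 // => w _.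
by rewrite linearZ /=; apply/ffunP => u; rewrite !ffunE E a0 scaler0.
Qed.

Lemma odd_inversionsE (m n r : nat) (s : 'S_r) (w : word m n r) :
  odd_inversions s w = (\sum_(a < r) \sum_(b < r)
    [&& a < b, s b < s a, odd_index (w a) & odd_index (w b)])%N.
Proof.
rewrite pair_bigA /= /odd_inversions -sum1_card big_mkcond /=.
by apply: eq_bigr => -[a b] _; rewrite inE /=; case: ifP.
Qed.

Lemma lker_Phi_pred (k : fieldType) (m n r : nat) :
  lker (Phi k m n r.+1) == 0%VS -> lker (Phi k m n r) == 0%VS.
Proof.
pose L (s : 'S_r) := lift_perm ord_max ord_max s : 'S_r.+1.
have injL : injective L.
  move=> s s' eqL; apply/permP => i; apply: (@lift_inj _ ord_max).
  by rewrite -!(lift_perm_lift ord_max) -/(L s) eqL.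
pose rst (w : word m n r.+1) : word m n r := [ffun i => w (lift ord_max i)].
have invL w s : odd_inversions (L s) w = odd_inversions s (rst w).
  have lt_max (i : 'I_r) : (lift ord_max i < @ord_max r)%N.
    by rewrite lift_max ltn_ord.
  rewrite !odd_inversionsE.
  have lift_sum (F : 'I_r.+1 -> nat) :
      (\sum_i F i = \sum_i F (lift ord_max i) + F ord_max)%N.
    rewrite big_ord_recr /=; congr (_ + _)%N.
    apply: eq_bigr => i _; congr F; apply: val_inj.
    by rewrite /= /bump leqNgt ltn_ord.
  rewrite lift_sum [X in (_ + X)%N]big1 ?addn0; last first.
    move=> b _; rewrite /L lift_perm_id.
    by rewrite ltnNge -ltnS ltn_ord.
  apply: eq_bigr => a _; rewrite lift_sum /L lift_perm_id !lift_perm_lift.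
  rewrite [X in (_ + X)%N](_ : _ = 0%N) ?addn0; last first.
    by rewrite [X in _ && (X && _)]ltnNge (ltnW (lt_max _)) andbF.
  apply: eq_bigr => b _; rewrite !lift_perm_lift !ffunE.
  by rewrite !lift_max.
have permL u w s : (u == perm_word (L s) w) =
    (rst u == perm_word s (rst w)) && (u ord_max == w ord_max).
  have LV i : ((L s)^-1)%g i = if unlift ord_max i is Some j
                then lift ord_max ((s^-1)%g j) else ord_max.
    rewrite /L lift_permV; case: unliftP => [j|] ->.
      by rewrite lift_perm_lift.
    by rewrite lift_perm_id.
  apply/eqP/andP => [-> | [/eqP eq_r /eqP eq_m]].
    split; apply/eqP; last by rewrite ffunE LV unlift_none.
    by apply/ffunP => i; rewrite !ffunE LV liftK.
  apply/ffunP => i; rewrite ffunE LV; case: unliftP => [j|] -> //.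
  by have /ffunP/(_ j) := eq_r; rewrite !ffunE.
move=> /lker0P inj; apply/lker0P/raddf_inj => a /Phi0P a0.
pose a' : group_algebra k r.+1 := [ffun s => \sum_s0 (s == L s0)%:R * a s0].
have a'L s : a' (L s) = a s.
  rewrite ffunE (bigD1 s) //= eqxx mul1r big1 ?addr0 // => s1 neq_s.
  by rewrite (inj_eq injL) eq_sym (negPf neq_s) mul0r.
suff a'0 : a' = 0 by apply/ffunP => s; rewrite -a'L a'0 !ffunE.
apply: inj; rewrite linear0; apply/Phi0P => w u.
under eq_bigr => s _ do rewrite ffunE mulr_suml.
rewrite exchange_big /=.
transitivity (\sum_s (a s : k) * ((-1) ^+ odd_inversions s (rst w)
    * (rst u == perm_word s (rst w))%:R) * (u ord_max == w ord_max)%:R : k).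
  apply: eq_bigr => s _; rewrite (bigD1 (L s)) //= eqxx mul1r big1.
    by rewrite addr0 invL permL -mulnb natrM -!mulrA.
  by move=> s1 neq_s; rewrite (negPf neq_s) !mul0r.
by rewrite -mulr_suml a0 mul0r.
Qed.

Lemma lker_Phi0 (k : fieldType) (m n : nat) : lker (Phi k m n 0) == 0%VS.
Proof.
apply/lker0P/raddf_inj => a /Phi0P a0; apply/ffunP => s0; rewrite ffunE.
pose w : word m n 0 := [ffun i : 'I_0 => False_rect _ (notF (valP i))].
have all1 (s : 'S_0) : s = s0 by apply/permP => -[].
have := a0 w w; rewrite (bigD1 s0) //= big1 => [|s]; last by rewrite (all1 s) eqxx.
have -> : w == perm_word s0 w by apply/eqP/ffunP => -[].
rewrite addr0 mulr1 => /eqP; rewrite mulf_eq0 signr_eq0 orbF => /eqP //.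
Qed.

Fact exists_lker_Phi0 (k : fieldType) (m n : nat) :
  exists r, lker (Phi k m n r) == 0%VS.
Proof. by exists 0%N; exact: lker_Phi0. Qed.

(* The largest r such that Phi^{(r)} is injective; the value 0, which is always
   allowed, is only attained when m = n = 0. *)
Definition r_p (k : fieldType) (m n : nat) : nat :=
  ex_maxn (exists_lker_Phi0 k m n) (@Phi_injective_bound k m n).

Lemma r_pP (k : fieldType) (m n r : nat) :
  injective (Phi k m n r) <-> (r <= r_p k m n)%N.
Proof.
rewrite /r_p; case: ex_maxnP => N kerN maxN; split=> [/lker0P/maxN // | le_rN].
apply/lker0P; move: kerN; rewrite -(subnKC le_rN).
by elim: (N - r)%N => [|d IHd]; rewrite ?addn0 // addnS => /lker_Phi_pred.
Qed.

(* Main.v *)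
Require Import Defs.
From HB Require Import structures.
From mathcomp Require Import all_boot all_order all_algebra all_fingroup.
From mathcomp Require Import pgroup zify ring.
Set Implicit Arguments.
Unset Strict Implicit.
Unset Printing Implicit Defensive.
Import Order.TTheory GRing.Theory Num.Theory.
Local Open Scope ring_scope.

(** Both assertions are statements about functions on the symmetric group S_r,
on which S_r acts by right translation.  Write eps(h, w) for the sign with which
h acts on the basis vector of a word w.  On the stabilizer Stab(w), a Young
subgroup, eps is the character that is trivial on the blocks of even letters and
is the signature on the blocks of odd letters.  Let X_w be the sum of
eps(h, w) h over Stab(w).  Comparing coefficients of basis vectors shows that an
element of the group algebra is killed by Phi exactly when the associated
function (inverted) and all its translates are killed by every X_w
([Phi_kernelP]).  So Phi fails to be injective as soon as some nonzero
S_r-module is killed by all the X_w: a matrix coefficient of that module is then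
a kernel element.

In characteristic zero Phi is injective for r < (m + 1)(n + 1)
([Phi_injective_char0]).  Take a nonzero module of functions and a vector
invariant under a Young subgroup that is as large as possible in dominance
order.  Maximality makes the vector a highest weight vector, and the lengths of
the rows decrease, so that row m (counting from 0) has at most n cells.  For
such a vector the antisymmetrizer of a column, summed over all choices of one
cell in each row, acts by a product of positive integers, as in the Capelli
identity; hence the rows from m on can be cut into at most n columns without
killing the vector ([columns_exist]).  The result is an eigenvector for the
character eps of Stab(w), where the even letters of w are the first m rows and
its odd letters are the columns, and X_w does not kill it.

For (i) it is enough that surjectivity implies injectivity when
r <= m + n + mn ([Phi_surjective_injective]).  A parity-preserving endomorphism
that commutes with the signed orbit sums of elementary matrices commutes with
GL(m|n), because the coefficients of the action of a matrix g are
S_r-equivariant up to sign ([GL_coef_perm], [End_GL_coef_sum]).  The conditions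
form a linear system with integer coefficients, so their solution space over k
is at least as large as over the rationals, where it contains the image of the
group algebra, of dimension r! by the case of characteristic zero
([commutant_transfer]).  If Phi is surjective over k, its image has therefore
dimension at least r!, and Phi is injective.

For (ii), suppose that m and n are positive and p <= m + n.  By the previous
implication it suffices to find r <= m + n + mn such that Phi is not injective.
If p <= n + 1, the trivial module of degree m(p - 1) + n + 1 is killed by every
X_w, because an odd letter occurs twice in w or an even letter occurs at least
p times; if p <= m + 1, the sign module of degree n(p - 1) + m + 1 is killed for
the same reason with the parities exchanged ([Phi_not_injective_character]).
Otherwise put l = p - m and take the simple module of the partition
(n + 1 + l, (n + 1)^(m - 1)), which has r = m(n + 1) + l cells
([Phi_not_injective_near_rectangle]).  It is realised by the function
column-row-column, the matrix coefficient of a polytabloid.  Besides the usual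
exchange relation of Specht modules ([column_exchange]) it satisfies one more
relation, between a full column and the l columns of length one, which holds
because l + m = p ([short_exchange]).  With these relations the cells carrying
one even letter can be moved into the short columns, and those carrying the
n odd letters into n of the n + 1 full columns ([letter_exchange]).  The m cells
of the last full column then carry only the m - 1 other even letters, so two of
them carry the same one, and X_w symmetrizes a transposition under which the
function is antisymmetric. *)

(** * Symmetric and antisymmetric functions on a symmetric group *)

Lemma tpermM_swap (T : finType) (s : {perm T}) (x y : T) :
  (tperm x y * s = s * tperm (s x) (s y))%g.
Proof. by rewrite -tpermJ conjgE !mulgA mulgV mul1g. Qed.

(** The transposition of x and s x, followed by s, fixes s x and every fixed point
of s; so a Young subgroup is generated by its transpositions. *)
Lemma preserving_perm_ind (T : finType) (C : eqType) (c : T -> C)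
    (P : {perm T} -> Prop) :
  P 1%g ->
  (forall x y (s : {perm T}), x != y -> c x = c y -> (forall z, c (s z) = c z) -> P s ->
     P (tperm x y * s)%g) ->
  forall s : {perm T}, (forall z, c (s z) = c z) -> P s.
Proof.
move=> P1 PM s; have [N] := ubnP #|[set z | s z != z]|.
elim: N s => // N IHN s ltN cs.
have [s1 | [x]] := set_0Vmem [set z | s z != z].
  suff -> : s = 1%g by [].
  apply/permP => z; rewrite perm1; apply/eqP; apply: contraFT (in_set0 z).
  by move=> sz; rewrite -s1 inE.
rewrite inE => sx.
have cs' z : c ((tperm x (s x) * s)%g z) = c z.
  by rewrite permM cs; case: tpermP => // ->; rewrite ?cs.
rewrite -[s]mul1g -(tperm2 x (s x)) -mulgA; apply: PM => //.
  by rewrite eq_sym.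
apply: IHN => //; rewrite -ltnS; apply: leq_trans ltN; rewrite ltnS.
apply: proper_card; apply/properP; split.
  apply/subsetP => z; rewrite !inE permM; apply: contraNneq => sz.
  rewrite tpermD ?sz //; first by apply: contraNneq sx => ->; rewrite sz.
  by apply: contraNneq sx => eq_z; apply/eqP; apply: (@perm_inj _ s); rewrite eq_z.
by exists (s x); rewrite !inE ?permM ?tpermR ?eqxx // (inj_eq perm_inj).
Qed.

Definition sym_on (R : pzRingType) (T : finType) (b : bool) (D : {set T})
    (f : {perm T} -> R) :=
  forall x y g, x \in D -> y \in D -> x != y ->
    f (g * tperm x y)%g = (-1) ^+ b * f g.

Lemma signMsign (R : pzRingType) (b : bool) (x : R) :
  (-1) ^+ b * ((-1) ^+ b * x) = x.
Proof. by rewrite mulrA -signr_addb addbb mul1r. Qed.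

(** The effect on f of the sum of coset representatives of the symmetric group on D
in the one on D and c, twisted by the sign when b holds. *)
Definition adjoin (R : pzRingType) (T : finType) (b : bool) (D : {set T})
    (c : T) (f : {perm T} -> R) (g : {perm T}) : R :=
  f g + (-1) ^+ b * \sum_(q in D) f (g * tperm q c)%g.

(** This one fact serves three times: to enlarge a row, to lengthen a column, and
to derive the exchange relations by the pigeonhole principle. *)
Lemma sym_on_adjoin (R : pzRingType) (T : finType) (b : bool) (D : {set T})
    (c : T) (f : {perm T} -> R) :
  sym_on b D f -> c \notin D -> sym_on b (c |: D) (adjoin b D c f).
Proof.
move=> fD cD.
have symc x g : x \in D -> adjoin b D c f (g * tperm x c) =
    (-1) ^+ b * adjoin b D c f g.
  move=> xD; rewrite /adjoin (bigD1 x) //= [in RHS](bigD1 x) //= mulrDr.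
  rewrite -mulgA tperm2 mulg1 !mulrDr !signMsign addrCA; congr (_ + (_ + _)).
  rewrite mulr_sumr; apply: eq_bigr => q /andP[qD neq_qx].
  have -> : (g * tperm x c * tperm q c = g * tperm q c * tperm x q)%g.
    rewrite -!mulgA; congr (_ * _)%g; rewrite tpermM_swap tpermR tpermD //.
    by apply: contraNneq cD => ->.
  by rewrite fD ?signMsign // eq_sym.
move=> x y g; rewrite !inE => /predU1P[-> | xD] /predU1P[-> | yD].
- by rewrite eqxx.
- by move=> _; rewrite tpermC symc.
- by move=> _; rewrite symc.
move=> neq_xy; have neqc z : z \in D -> z != c.
  by move=> zD; apply: contraNneq cD => <-.
rewrite /adjoin mulrDr fD //; congr (_ + _ * _).
rewrite (reindex_inj (@perm_inj _ (tperm x y))) mulr_sumr /=.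
apply: eq_big => [q | q qD].
  by case: tpermP => // ->; rewrite ?xD ?yD.
have -> : (g * tperm x y * tperm (tperm x y q) c = g * tperm q c * tperm x y)%g.
  rewrite -!mulgA; congr (_ * _)%g.
  by rewrite [RHS]tpermM_swap [tperm x y c]tpermD ?neqc.
by rewrite fD.
Qed.

Definition antisymmetrize (R : pzRingType) (T : finType) (B : {set T})
    (f : {perm T} -> R) (g : {perm T}) : R :=
  \sum_(s | perm_on B s) (-1) ^+ s * f (g * s)%g.

Lemma antisymmetrizeMr (R : pzRingType) (T : finType) (B : {set T})
    (f : {perm T} -> R) (g t : {perm T}) : perm_on B t ->
  antisymmetrize B f (g * t)%g = (-1) ^+ t * antisymmetrize B f g.
Proof.
move=> Bt; rewrite /antisymmetrize [RHS]mulr_sumr.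
rewrite [RHS](reindex_inj (mulgI t)) /=; apply: eq_big => [s | s _].
  apply/idP/idP => [|Bts]; first exact: perm_onM.
  by rewrite -[s](mulKg t) perm_onM // perm_onV.
by rewrite odd_permM signr_addb -mulrA signMsign mulgA.
Qed.

Lemma antisymmetrize_translate (R : pzRingType) (T : finType) (B : {set T})
    (f : {perm T} -> R) (g t : {perm T}) : perm_on B t ->
  antisymmetrize B (fun h => f (h * t)%g) g = (-1) ^+ t * antisymmetrize B f g.
Proof.
move=> Bt; rewrite /antisymmetrize [RHS]mulr_sumr.
rewrite [RHS](reindex_inj (mulIg t)) /=; apply: eq_big => [s | s _].
  apply/idP/idP => [Bs|Bst]; first exact: perm_onM.
  by rewrite -[s](mulgK t) perm_onM // perm_onV.
by rewrite odd_permM addbC signr_addb -mulrA signMsign mulgA.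
Qed.

Lemma antisymmetrize_disjoint (R : pzRingType) (T : finType) (B : {set T})
    (f : {perm T} -> R) (g : {perm T}) x y : x \notin B -> y \notin B ->
  antisymmetrize B (fun h => f (h * tperm x y)%g) g =
    antisymmetrize B f (g * tperm x y)%g.
Proof.
move=> xB yB; apply: eq_bigr => s Bs; rewrite -!mulgA; congr (_ * f (_ * _)%g).
by rewrite tpermM_swap !(out_perm Bs).
Qed.

Lemma antisymmetrizeD (R : comPzRingType) (T : finType) (I : Type) (r : seq I)
    (P : pred I) (B : {set T}) (f : {perm T} -> R) (c : R)
    (F : I -> {perm T} -> R) (g : {perm T}) :
  antisymmetrize B (fun h => f h + c * \sum_(i <- r | P i) F i h) g =
    antisymmetrize B f g + c * \sum_(i <- r | P i) antisymmetrize B (F i) g.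
Proof.
rewrite /antisymmetrize exchange_big mulr_sumr -big_split; apply: eq_bigr => s _.
by rewrite mulrDr mulrCA mulr_sumr.
Qed.

(** In this form [preserving_perm_ind] applies to [perm_on]: the colouring gives
one colour to B and a private colour to each point outside. *)
Lemma perm_onP (T : finType) (B : {set T}) (s : {perm T}) :
  perm_on B s <-> forall z, (if s z \in B then None else Some (s z)) =
                            (if z \in B then None else Some z).
Proof.
split=> [Bs z | Bs].
  by rewrite (perm_closed z Bs); case: ifP => // /negbT zB; rewrite (out_perm Bs).
apply/subsetP => z; rewrite inE; apply: contraR => zB.
by have := Bs z; rewrite (negPf zB); case: ifP => // _ [->].
Qed.

Lemma sym_on_perm (R : pzRingType) (T : finType) (b : bool) (B : {set T})
    (f : {perm T} -> R) (s g : {perm T}) :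
  sym_on b B f -> perm_on B s -> f (g * s)%g = (-1) ^+ (b && s) * f g.
Proof.
move=> fB /perm_onP Bs; move: g; move: s Bs.
pose c z := if z \in B then None else Some z.
apply: (@preserving_perm_ind _ _ c (fun s => forall g,
    f (g * s)%g = (-1) ^+ (b && s) * f g)) => [g | x y s neq_xy eq_c _ IH g].
  by rewrite mulg1 odd_perm1 andbF mul1r.
have /andP[xB yB] : (x \in B) && (y \in B).
  move: eq_c; rewrite /c; case: ifP => // _; case: ifP => // _ [eq_xy].
  by rewrite eq_xy eqxx in neq_xy.
rewrite mulgA IH fB // odd_permM odd_tperm neq_xy.
by case: (b); case: (odd_perm s); rewrite /= ?expr0 ?expr1 ?mulN1r ?mul1r ?opprK.
Qed.

Lemma antisymmetrize_sym (R : pzRingType) (T : finType) (B : {set T})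
    (f : {perm T} -> R) (g : {perm T}) :
  sym_on true B f -> antisymmetrize B f g = (#|B|`!)%:R * f g.
Proof.
move=> fB; rewrite /antisymmetrize -card_perm -sum1_card natr_sum mulr_suml.
by apply: eq_bigr => s Bs; rewrite (sym_on_perm _ fB Bs) signMsign mul1r.
Qed.

(** * Columns of a highest weight vector *)

(** The hypothesis says that v is a highest weight vector: moving a cell to a
higher row gives zero.  The rows are treated from the bottom up.  If B is a
partial column below row j, adjoining each cell x of row j to B and summing over
x multiplies the vector by the length of row j plus the size of B: the identity
term contributes the length, and each point of B contributes 1 by the
hypothesis.  This factor is positive, so some x gives a nonzero vector. *)
Lemma column_exists (F : numFieldType) (T : finType) (U : {set T})
    (c : T -> nat) (v : {perm T} -> F) :
  (forall b j g, b \in U -> (j < c b)%N ->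
     v g + \sum_(a in U | c a == j) v (g * tperm a b)%g = 0) ->
  (exists g, v g != 0) ->
  exists B : {set T}, [/\ B \subset U, {in B &, injective c},
    forall b, b \in U -> exists2 a, a \in B & c a = c b
    & exists g, antisymmetrize B v g != 0].
Proof.
move=> raise_v v_neq0.
(* The last clause records that u comes from v by permutations of B, so that a
   full antisymmetrizer does not kill v if it does not kill u. *)
pose good (j : nat) (B : {set T}) (u : {perm T} -> F) :=
  [/\ [/\ B \subset U, {in B &, injective c} & forall b, b \in B -> (j <= c b)%N],
     forall b, b \in U -> (j <= c b)%N -> exists2 a, a \in B & c a = c b,
     (exists g, u g != 0) /\ sym_on true B u,
     forall b i g, b \in U -> (i < c b)%N -> (i < j)%N ->
       u g + \sum_(a in U | c a == i) u (g * tperm a b)%g = 0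
   & forall B' : {set T}, B \subset B' -> exists t, forall g,
       antisymmetrize B' u g = t * antisymmetrize B' v g].
suff [B [u [[BU injB _] fullB [[g ug] asymB] _ /(_ B (subxx _))[t eq_t]]]] :
    exists B u, good 0%N B u.
  exists B; split=> // [b bU|]; first exact: fullB.
  exists g; apply: contraNneq ug => vg; have := eq_t g.
  rewrite vg mulr0 antisymmetrize_sym // => /eqP.
  by rewrite mulf_eq0 pnatr_eq0 eqn0Ngt fact_gt0.
have [J leJ] : exists J, forall x, (c x < J)%N.
  by exists (\max_x c x).+1 => x; rewrite ltnS leq_bigmax.
have [d def_d] : exists d, d = J by exists J.
have {def_d} : (J - d = 0)%N by rewrite def_d subnn.
(* The row index j of the invariant good j decreases from J, below all rows. *)
suff step k : exists B u, good (J - k)%N B u.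
  by move <-; apply: step.
elim: k => [|k [B [u [[BU injB geB] fullB [u0 asymB] raise_u span_u]]]].
  rewrite subn0; exists set0, v; split=> //.
  - by split; [exact: sub0set | move=> x y; rewrite inE | move=> x; rewrite inE].
  - by move=> b _; rewrite leqNgt leJ.
  - by split=> // x y g; rewrite inE.
  - by move=> b i g bU lti _; apply: raise_v.
  by move=> B' _; exists 1 => g; rewrite mul1r.
have [leJk | ltkJ] := leqP J k.
  exists B, u; have -> : (J - k.+1 = J - k)%N by lia.
  by split.
set j := (J - k.+1)%N; have def_j : (J - k = j.+1)%N by rewrite /j; lia.
rewrite def_j in geB fullB raise_u.
pose A := [set a in U | c a == j].
have [A0 | [x0 x0A]] := set_0Vmem A.
  exists B, u; split=> //.
  - by split=> // b /geB; apply: ltnW.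
  - move=> b bU; rewrite leq_eqVlt => /predU1P[eq_j | ]; last exact: fullB.
    by have := in_set0 b; rewrite -A0 inE bU -eq_j eqxx.
  by move=> b i g bU lt_ib lt_ij; apply: raise_u => //; apply: ltnW.
have [g ug] := u0.
have [x /andP[xA ux]] : exists x, (x \in A) && (adjoin true B x u g != 0).
  apply/existsP; apply: contraNT ug; rewrite negb_exists => /forallP all0.
  have : \sum_(x in A) adjoin true B x u g = 0.
    apply: big1 => x xA; apply/eqP.
    by have := all0 x; rewrite xA /= negbK.
  rewrite /adjoin big_split /= sumr_const -mulr_sumr exchange_big /=.
  rewrite (eq_bigr (fun _ => - u g)); last first.
    move=> b bB; have bU := subsetP BU b bB.
    have := raise_u b j g bU (geB b bB) (ltnSn j) => /eqP.
    rewrite addrC addr_eq0 => /eqP <-.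
    by apply: eq_big => [a | a _]; rewrite ?inE // tpermC.
  rewrite sumr_const mulN1r mulNrn opprK -mulrnDr => /eqP.
  by rewrite mulrn_eq0 addn_eq0 cards_eq0 => /orP[/andP[/eqP A0]|//]; rewrite A0 inE in x0A.
have /andP[xU /eqP cx] : (x \in U) && (c x == j) by move: xA; rewrite inE.
have xB : x \notin B by apply: contraL (ltnSn j) => /geB; rewrite cx ltnn.
exists (x |: B), (adjoin true B x u); split.
- split; first by rewrite subUset sub1set xU.
    move=> y z; rewrite !inE => /predU1P[-> | yB] /predU1P[-> | zB] //.
    + by move=> eq_c; have := geB z zB; rewrite -eq_c cx ltnn.
    + by move=> eq_c; have := geB y yB; rewrite eq_c cx ltnn.
    exact: injB.
  by move=> b /setU1P[-> | /geB/ltnW //]; rewrite cx.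
- move=> b bU; rewrite leq_eqVlt => /predU1P[eq_j | ltj].
    by exists x; rewrite ?setU11 // cx.
  by have [a aB eq_c] := fullB b bU ltj; exists a; rewrite ?setU1r.
- by split; [exists g | exact: sym_on_adjoin].
- move=> b i h bU lt_ib lt_ij; rewrite /adjoin big_split /= addrACA.
  rewrite raise_u // ?add0r; last exact: ltnW.
  rewrite -mulr_sumr -mulrDr exchange_big -big_split big1 ?mulr0 //= => q qB.
  have qU := subsetP BU q qB.
  (* Translating by the transposition of q and x turns the raising relation of
     b into that of its image b', which still lies below row i. *)
  pose b' := tperm q x b.
  have b'U : b' \in U by rewrite /b'; case: tpermP.
  have lt_ib' : (i < c b')%N.
    by rewrite /b'; case: tpermP => // _; rewrite ?cx // (ltn_trans lt_ij) ?geB.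
  rewrite -[RHS](raise_u b' i (h * tperm q x)%g) //; last exact: ltnW.
  congr (_ + _); apply: eq_bigr => a /andP[aU /eqP ca].
  rewrite -!mulgA tpermM_swap -/b' [tperm q x a]tpermD //.
    by apply: contraTneq lt_ij => eq_qa; rewrite -ca -eq_qa -leqNgt ltnW ?geB.
  by apply: contraTneq lt_ij => eq_xa; rewrite -ca -eq_xa cx ltnn.
move=> B'; rewrite subUset sub1set => /andP[xB' BB'].
have [t eq_t] := span_u B' BB'; exists (t * (1 + #|B|%:R)) => h.
rewrite /adjoin antisymmetrizeD (eq_bigr (fun _ => - antisymmetrize B' u h)).
  by rewrite sumr_const mulN1r mulNrn opprK eq_t -mulr_natr; ring.
move=> q qB; rewrite antisymmetrize_translate.
  by rewrite odd_tperm (contraTneq _ qB) ?expr1 ?mulN1r // => ->.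
apply/perm_onP => z.
by case: tpermP => [->|->|]; rewrite ?xB' ?(subsetP BB' _ qB).
Qed.

Lemma eq_opp_eq0 (F : fieldType) (x : F) : 2%:R != 0 :> F -> x = - x -> x = 0.
Proof.
move=> two_neq0 /eqP; rewrite -addr_eq0 -mulr2n -mulr_natl mulf_eq0.
by rewrite (negPf two_neq0) => /eqP.
Qed.

Lemma antisymmetrize_outside (R : comPzRingType) (T : finType) (B : {set T})
    (f : {perm T} -> R) (e : R) x y : x \notin B -> y \notin B ->
  (forall g, f (g * tperm x y)%g = e * f g) ->
  forall g, antisymmetrize B f (g * tperm x y)%g = e * antisymmetrize B f g.
Proof.
move=> xB yB fxy g; rewrite -antisymmetrize_disjoint // /antisymmetrize mulr_sumr.
by apply: eq_bigr => s _; rewrite fxy mulrCA.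
Qed.

(** Removing a column keeps the vector of highest weight.  The raising relation
for v is antisymmetrized over B; the term of a cell a of B in row j must then
vanish.  Let i be the cell of B in the row of b.  As v is invariant under the
transposition of b and i, that term does not change when it is translated by the
transposition of a and i, while the antisymmetrizer changes its sign. *)
Lemma antisymmetrize_raise (F : numFieldType) (T : finType) (U B : {set T})
    (c : T -> nat) (v : {perm T} -> F) :
  (forall x y g, x \in U -> y \in U -> x != y -> c x = c y ->
     v (g * tperm x y)%g = v g) ->
  (forall b j g, b \in U -> (j < c b)%N ->
     v g + \sum_(a in U | c a == j) v (g * tperm a b)%g = 0) ->
  B \subset U -> (forall b, b \in U -> exists2 a, a \in B & c a = c b) ->
  forall b j g, b \in U :\: B -> (j < c b)%N ->
    antisymmetrize B v g +
      \sum_(a in U :\: B | c a == j) antisymmetrize B v (g * tperm a b)%g = 0.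
Proof.
move=> row_v raise_v BU fullB b j g /setDP[bU bB] lt_jb.
have := antisymmetrizeD (enum T) (fun a => (a \in U) && (c a == j)) B v 1
  (fun a h => v (h * tperm a b)%g) g.
rewrite {1}/antisymmetrize big1 ?mul1r => [|s _]; last first.
  by rewrite mul1r big_enum_cond raise_v // mulr0.
move=> eq0; rewrite [RHS]eq0; congr (_ + _).
rewrite [RHS]big_enum_cond [RHS](bigID (mem B)) /=.
rewrite [X in _ = X + _]big1 ?add0r => [|a /andP[/andP[aU /eqP ca] aB]].
  apply: eq_big => [a | a]; first by rewrite inE -andbA andbC.
  by case/andP=> /setDP[aU aB] _; rewrite antisymmetrize_disjoint.
have [i iB ci] := fullB b bU.
have neq_ai : a != i.
  by apply: contraTneq lt_jb => eq_ai; rewrite -ca -ci eq_ai ltnn.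
have neq_bi : b != i by apply: contraNneq bB => ->.
apply: eq_opp_eq0; first by rewrite pnatr_eq0.
have Bai : perm_on B (tperm a i).
  by apply/perm_onP => z; case: tpermP => [->|->|]; rewrite ?aB ?iB.
have := antisymmetrize_translate (fun h => v (h * tperm a b)%g) g Bai.
rewrite odd_tperm neq_ai expr1 mulN1r => <-.
apply: eq_bigr => s _; congr (_ * _).
rewrite -!mulgA [(tperm a i * _)%g]tpermM_swap tpermL [tperm a b i]tpermD //.
by rewrite !mulgA [RHS]row_v ?ci //; apply: (subsetP BU).
Qed.

(** Each step removes one cell from row 0 of U.  Once row 0 is empty all of U is
empty, as the raising relation into an empty row says that v is zero. *)
Lemma columns_exist (F : numFieldType) (T : finType)
    (K : ({perm T} -> F) -> Prop) (c : T -> nat) (n : nat) (U : {set T})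
    (v : {perm T} -> F) :
  (forall B f, K f -> K (antisymmetrize B f)) ->
  (#|[set x in U | c x == 0%N]| <= n)%N ->
  (forall x y g, x \in U -> y \in U -> x != y -> c x = c y ->
     v (g * tperm x y)%g = v g) ->
  (forall b j g, b \in U -> (j < c b)%N ->
     v g + \sum_(a in U | c a == j) v (g * tperm a b)%g = 0) ->
  K v -> (exists g, v g != 0) ->
  exists (d : T -> nat) (v' : {perm T} -> F),
  [/\ K v', exists g, v' g != 0, forall x, x \in U -> (d x < n)%N,
      forall x y g, x \in U -> y \in U -> x != y -> d x = d y ->
        v' (g * tperm x y)%g = - v' g
    & forall x y e, x \notin U -> y \notin U ->
        (forall g, v (g * tperm x y)%g = e * v g) ->
        forall g, v' (g * tperm x y)%g = e * v' g].
Proof.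
move=> closedK; elim: n U v => [|n IHn] U v le_n row_v raise_v Kv nz_v.
  have U0 x : x \in U -> False.
    have noU0 y : y \in U -> c y != 0%N.
      move=> yU; apply: contraTneq le_n => cy; rewrite -ltnNge.
      by apply/card_gt0P; exists y; rewrite inE yU cy.
    move=> xU; have [g] := nz_v.
    have := raise_v x 0%N g xU; rewrite lt0n noU0 // => /(_ isT).
    rewrite big_pred0 ?addr0; first by move->; rewrite eqxx.
    by move=> a; case: (boolP (a \in U)) => // /noU0/negPf ->.
  by exists (fun=> 0%N), v; split=> // [x /U0 | x y g /U0].
have [B [BU injB fullB nzB]] := column_exists raise_v nz_v.
have := IHn (U :\: B) (antisymmetrize B v) _ _ _ (closedK B v Kv) nzB.
case.
- have sub0 : [set x in U :\: B | c x == 0%N] \subset [set x in U | c x == 0%N].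
    by apply/subsetP => z; rewrite !inE => /andP[/andP[_ ->]].
  have [row0 | [x]] := set_0Vmem [set x in U | c x == 0%N].
    by rewrite (leq_trans (subset_leq_card sub0)) // row0 cards0.
  rewrite inE => /andP[xU /eqP cx].
  have [a aB ca] := fullB x xU.
  rewrite -ltnS; apply: leq_trans le_n; apply: proper_card; apply/properP; split=> //.
  by exists a; rewrite !inE ?aB // (subsetP BU) //= ca cx.
- move=> x y g /setDP[xU xB] /setDP[yU yB] neq_xy eq_c.
  rewrite (antisymmetrize_outside (e := 1) xB yB) ?mul1r // => h.
  by rewrite mul1r row_v.
- exact: antisymmetrize_raise.
move=> d [v' [Kv' nz_v' ltd sym_v' out_v']].
exists (fun x => if x \in B then n else d x), v'; split=> //.
- move=> x xU; case: ifP => // xB; rewrite ltnS ltnW // ltd //.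
  by rewrite inE xB.
- move=> x y g xU yU neq_xy.
  have memD z : z \in U -> (z \in U :\: B) = (z \notin B).
    by move=> zU; rewrite inE zU andbT.
  case: ifPn => xB; case: ifPn => yB eq_d.
  + rewrite (out_v' x y (-1)) ?mulN1r ?inE ?xB ?yB // => h.
    rewrite antisymmetrizeMr ?odd_tperm ?neq_xy //.
    by apply/perm_onP => z; case: tpermP => [->|->|]; rewrite ?xB ?yB.
  + by have := ltd y; rewrite memD // -eq_d ltnn => /(_ yB).
  + by have := ltd x; rewrite memD // eq_d ltnn => /(_ xB).
  by apply: sym_v'; rewrite ?memD.
move=> x y e xU yU v_xy.
have notB z : z \notin U -> z \notin B by apply: contraNN => /(subsetP BU).
apply: out_v'; rewrite ?inE ?(negPf xU) ?(negPf yU) ?andbF //.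
by apply: antisymmetrize_outside; rewrite ?notB.
Qed.

(** Otherwise the m + 1 first rows would have more than n cells each. *)
Lemma short_rows (T : finType) (c : T -> nat) (m n : nat) :
  (forall j l, (j < l)%N -> (#|[set x | c x == l]| <= #|[set x | c x == j]|)%N) ->
  (#|T| < m.+1 * n.+1)%N -> (#|[set x | c x == m]| <= n)%N.
Proof.
move=> decr; apply: contraTT; rewrite -ltnNge -leqNgt => long.
apply: (@leq_trans (\sum_(j < m.+1) #|[set x | c x == j]|)).
  rewrite -[X in (X * _)%N]card_ord -sum_nat_const leq_sum // => j _.
  apply: leq_trans long _; have := ltn_ord j; rewrite ltnS leq_eqVlt.
  by case/predU1P=> [-> // | /decr].
have <- : (\sum_(x | (c x < m.+1)%N) 1 = \sum_(j < m.+1) #|[set x | c x == j]|)%N.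
  rewrite (partition_big (fun x => inord (c x) : 'I_m.+1) predT) //=.
  apply: eq_bigr => j _; rewrite -sum1_card; apply: eq_bigl => x; rewrite inE.
  apply/andP/eqP => [[ltx /eqP <-] | ->]; first by rewrite inordK.
  by rewrite ltn_ord inord_val.
by rewrite sum1_card max_card.
Qed.

(** * Vectors of hook shape in characteristic zero *)

(** Among the colourings for which K contains a nonzero vector invariant under
the permutations of each colour, one with the least sum of colours is found by
descent: if a raising relation fails, the raised vector is invariant for the
colouring in which b has moved to row j, and if row l is longer than row j < l,
the two colours can be exchanged. *)
Lemma hook_word_exists (F : numFieldType) (T : finType) (m n : nat)
    (K : ({perm T} -> F) -> Prop) (f : {perm T} -> F) :
  (forall B f, K f -> K (antisymmetrize B f)) ->
  (forall D b f, K f -> K (adjoin false D b f)) ->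
  (#|T| < m.+1 * n.+1)%N -> K f -> (exists g, f g != 0) ->
  exists (w : T -> 'I_(m + n)) (v : {perm T} -> F),
  [/\ K v, exists g, v g != 0
    & forall x y g, x != y -> w x = w y ->
        v (g * tperm x y)%g = (-1) ^+ odd_index (w x) * v g].
Proof.
move=> closedY closedA ltT Kf nz_f.
have [c row_f] : exists c : T -> nat, forall x y g, x != y -> c x = c y ->
    f (g * tperm x y)%g = f g.
  exists (fun x => enum_rank x : nat) => x y g neq_xy /val_inj/enum_rank_inj eq_xy.
  by rewrite eq_xy eqxx in neq_xy.
have [N] := ubnP (\sum_x c x)%N; elim: N c f Kf nz_f row_f => // N IHN c f Kf nz_f row_f ltN.
have [raise_f | /forallPn[b]] := boolP [forall b, [forall j : 'I_(c b),
    [forall g, f g + \sum_(a | c a == j) f (g * tperm a b)%g == 0]]]; last first.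
  case/forallPn=> j /forallPn[g nz_g]; set A := [set a | c a == j].
  have bA : b \notin A by rewrite inE gtn_eqF ?ltn_ord.
  have symA : sym_on false A f.
    by move=> x y h; rewrite !inE expr0 mul1r => /eqP cx /eqP cy neq_xy; rewrite row_f // cx.
  have symA' := sym_on_adjoin symA bA.
  apply: (IHN (fun x => if x == b then j : nat else c x) (adjoin false A b f)).
  - exact: closedA.
  - exists g; rewrite /adjoin expr0 mul1r; move: nz_g; rewrite /A.
    by congr (_ + _ != 0); apply: eq_bigl => a; rewrite inE.
  - move=> x y h neq_xy eq_c.
    have [xyA | xyA] := boolP ((x \in b |: A) && (y \in b |: A)).
      by case/andP: xyA => xA yA; rewrite symA' // expr0 mul1r.
    have bjA z : ((if z == b then j : nat else c z) == j) = (z \in b |: A).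
      by rewrite !inE; case: (z == b); rewrite ?eqxx.
    have eqA : (x \in b |: A) = (y \in b |: A) by rewrite -!bjA eq_c.
    have [xA yA] : x \notin b |: A /\ y \notin b |: A.
      by move: xyA; rewrite -eqA andbb.
    move: eq_c xA yA; rewrite !inE !negb_or.
    case: eqP => // /eqP xb; case: eqP => // /eqP yb eq_c /= xA yA.
    rewrite /adjoin row_f //; congr (_ + _ * _); apply: eq_bigr => a; rewrite inE => aA.
    have -> : (h * tperm x y * tperm a b = h * tperm a b * tperm x y)%g.
      rewrite -!mulgA; congr (_ * _)%g; rewrite tpermM_swap !tpermD //.
      1-4: by [rewrite eq_sym | apply: contraNneq xA => <- | apply: contraNneq yA => <-].
    by rewrite row_f.
  rewrite -ltnS; apply: leq_trans ltN; rewrite ltnS (bigD1 b) //= eqxx.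
  rewrite [X in (_ < X)%N](bigD1 b) //= -addSn leq_add ?ltn_ord //.
  by apply: leq_sum => x /negPf ->.
have {}raise_f b j g : (j < c b)%N ->
    f g + \sum_(a | c a == j) f (g * tperm a b)%g = 0.
  move=> lt_jb; apply/eqP.
  by move/forallP/(_ b)/forallP/(_ (Ordinal lt_jb))/forallP/(_ g): raise_f.
have [/forallP decr | /forallPn[y /forallPn[j]]] := boolP [forall y, [forall j : 'I_(c y),
    #|[set x | c x == c y]| <= #|[set x | c x == j]|]%N]; last first.
  rewrite -ltnNge => lt_jl; have lt_jy := ltn_ord j.
  move: {j}(j : nat) lt_jl lt_jy => j; set l := c y => lt_jl lt_jy.
  (* The colours j and l are exchanged; this lowers the sum of the colours. *)
  pose c' x := if c x == j then l else if c x == l then j else c x.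
  have c'K x z : c' x = c' z -> c x = c z.
    rewrite /c'.
    by case: (c x =P j); case: (c z =P j); case: (c x =P l); case: (c z =P l); lia.
  apply: (IHN c' f) => // [x z g neq_xz /c'K|]; first exact: row_f.
  rewrite -ltnS; apply: leq_trans ltN; rewrite ltnS.
  rewrite -(ltn_add2r ((l - j) * #|[set x | c x == l]|)).
  apply: (@leq_ltn_trans (\sum_x c x + (l - j) * #|[set x | c x == j]|)%N); last first.
    by rewrite ltn_add2l ltn_pmul2l // subn_gt0.
  rewrite -!sum1_card !big_distrr [X in (_ + X <= _)%N]big_mkcond.
  rewrite [X in (_ <= _ + X)%N]big_mkcond -!big_split /=.
  by apply: leq_sum => x _; rewrite /c' !inE; do 2!case: eqP => ?; lia.
have {}decr j l : (j < l)%N -> (#|[set x | c x == l]| <= #|[set x | c x == j]|)%N.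
  move=> lt_jl; have [-> | [y]] := set_0Vmem [set x | c x == l].
    by rewrite cards0.
  rewrite inE => /eqP cy; rewrite -cy in lt_jl *.
  exact: (forallP (decr y) (Ordinal lt_jl)).
have le_n : (#|[set x | c x == m]| <= n)%N by exact: short_rows decr ltT.
pose U := [set x | (m <= c x)%N].
have [d [v [Kv nz_v ltd sym_v out_v]]] :
    exists (d : T -> nat) (v' : {perm T} -> F),
  [/\ K v', exists g, v' g != 0, forall x, x \in U -> (d x < n)%N,
      forall x y g, x \in U -> y \in U -> x != y -> d x = d y ->
        v' (g * tperm x y)%g = - v' g
    & forall x y e, x \notin U -> y \notin U ->
        (forall g, f (g * tperm x y)%g = e * f g) ->
        forall g, v' (g * tperm x y)%g = e * v' g].
  apply: (@columns_exist _ _ _ (fun x => c x - m)%N) => //.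
  - apply: leq_trans le_n; apply: subset_leq_card; apply/subsetP => x.
    by rewrite !inE => /andP[lemx]; rewrite subn_eq0 eqn_leq lemx andbT.
  - move=> x y g; rewrite !inE => lemx lemy neq_xy eq_c; apply: row_f => //.
    by rewrite -(subnK lemx) eq_c subnK.
  - move=> b j g; rewrite inE => lemb; rewrite ltn_subRL => lt_jb.
    rewrite -[RHS](raise_f b (m + j)%N g) //; congr (_ + _).
    apply: eq_bigl => a; rewrite inE; case: leqP => [lema | ltam] /=.
      by rewrite -(eqn_add2l m) subnKC.
    by apply/esym/negbTE; rewrite neq_ltn (leq_trans ltam (leq_addr _ _)).
pose k x := if (c x < m)%N then c x else (m + d x)%N.
have k_lt x : (k x < m + n)%N.
  rewrite /k; case: (ltnP (c x) m) => [ltc | lec]; first exact: ltn_addr.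
  by rewrite ltn_add2l ltd // inE.
exists (fun x => Ordinal (k_lt x)), v; split=> // x y g neq_xy [eq_k].
rewrite /odd_index /=; move: eq_k; rewrite /k.
case: (ltnP (c x) m) => cx; case: (ltnP (c y) m) => cy eq_k.
- rewrite leqNgt cx expr0; apply: out_v; rewrite ?inE -?ltnNge // => h.
  by rewrite mul1r row_f.
- by move: cx; rewrite eq_k ltnNge leq_addr.
- by move: cy; rewrite -eq_k ltnNge leq_addr.
rewrite leq_addr expr1 mulN1r sym_v ?inE //.
exact: (@addnI m).
Qed.

(** * The sign of a permutation acting on a word *)

Lemma perm_wordM (m n r : nat) (s t : 'S_r) (w : word m n r) :
  perm_word (s * t)%g w = perm_word t (perm_word s w).
Proof. by apply/ffunP => i; rewrite !ffunE invMg permM. Qed.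

Lemma perm_word1 (m n r : nat) (w : word m n r) : perm_word 1%g w = w.
Proof. by apply/ffunP => i; rewrite ffunE invg1 perm1. Qed.

Lemma perm_word_perm (m n r : nat) (s : 'S_r) (w : word m n r) i :
  perm_word s w (s i) = w i.
Proof. by rewrite ffunE permK. Qed.

Lemma perm_word_id (m n r : nat) (s : 'S_r) (w : word m n r) :
  reflect (forall z, w (s z) = w z) (perm_word s w == w).
Proof.
apply: (iffP eqP) => [ws z | ws]; first by rewrite -[in RHS](perm_word_perm s) ws.
by apply/ffunP => i; rewrite ffunE -ws permKV.
Qed.

(** Twice either side, plus the diagonal, is the sum over all pairs. *)
Lemma big_ltn_perm (r : nat) (f : 'I_r -> 'I_r -> nat) (s : 'S_r) :
  (forall a b, f a b = f b a) ->
  (\sum_(a < r) \sum_(b < r | (a < b)%N) f (s a) (s b) =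
     \sum_(a < r) \sum_(b < r | (a < b)%N) f a b)%N.
Proof.
move=> symf.
have double g : (forall a b, g a b = g b a) ->
    (\sum_(a < r) \sum_(b < r) g a b =
      (\sum_(a < r) \sum_(b < r | (a < b)%N) g a b).*2 + \sum_(a < r) g a a)%N.
  move=> symg; rewrite -addnn [X in _ = (_ + X + _)%N](exchange_big_dep predT) //= -!big_split /=.
  apply: eq_bigr => a _; rewrite (bigID (fun b : 'I_r => a < b)%N) /= -addnA.
  congr (_ + _)%N; rewrite (bigD1 a) ?ltnn //= addnC; congr (_ + _)%N.
  apply: eq_big => [b | b _]; last exact: symg.
  by rewrite -leqNgt ltn_neqAle andbC.
apply: double_inj; apply/eqP; rewrite -(eqn_add2r (\sum_(a < r) f a a)) -double //.
rewrite [in X in (_ + X)%N](reindex_inj (@perm_inj _ s)) -double //=.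
rewrite [eqbRHS](reindex_inj (@perm_inj _ s)) /=; apply/eqP; apply: eq_bigr => a _.
by rewrite [RHS](reindex_inj (@perm_inj _ s)).
Qed.

Lemma odd_sum_addb (I : Type) (r : seq I) (P : pred I) (F G : I -> bool) :
  odd (\sum_(i <- r | P i) (F i (+) G i)) =
    odd (\sum_(i <- r | P i) F i) (+) odd (\sum_(i <- r | P i) G i).
Proof.
rewrite -oddD -big_split; elim/big_rec2: _ => //= i x y _ eq_xy.
by rewrite !oddD eq_xy !oddb.
Qed.

Lemma ltn_ord_neg (r : nat) (i j : 'I_r) : i != j -> (j < i)%N = ~~ (i < j)%N.
Proof. by move=> neq_ij; rewrite ltnNge leq_eqVlt val_eqE (negPf neq_ij). Qed.

(** The pair of positions a, b is inverted by s t exactly when one of s (at a, b)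
and t (at the images) inverts it.  Being inverted is a symmetric condition on
the pair, which is what makes [big_ltn_perm] applicable. *)
Lemma odd_inversionsM (m n r : nat) (s t : 'S_r) (w : word m n r) :
  odd (odd_inversions (s * t)%g w) =
    odd (odd_inversions s w) (+) odd (odd_inversions t (perm_word s w)).
Proof.
pose f (s : 'S_r) (w : word m n r) (a b : 'I_r) : bool :=
  [&& odd_index (w a), odd_index (w b) & (a < b)%N (+) (s a < s b)%N].
have fE s' w' : odd_inversions s' w' =
    (\sum_(a < r) \sum_(b < r | (a < b)%N) f s' w' a b)%N.
  rewrite odd_inversionsE; apply: eq_bigr => a _; rewrite [RHS]big_mkcond.
  apply: eq_bigr => b _; rewrite /f; case: ltnP => //= lt_ab.
  rewrite -leqNgt [(s' b <= s' a)%N]leq_eqVlt (inj_eq val_inj) (inj_eq perm_inj).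
  by rewrite -val_eqE gtn_eqF //=; do 2!case: odd_index; rewrite ?andbT ?andbF.
have symf a b : f t (perm_word s w) a b = f t (perm_word s w) b a :> nat.
  have [-> //|neq_ab] := eqVneq a b.
  rewrite /f (ltn_ord_neg neq_ab) (@ltn_ord_neg _ (t a)) ?(inj_eq perm_inj) //.
  by rewrite addbN addNb negbK andbCA.
rewrite !fE -(big_ltn_perm s symf) !pair_big_dep /= -odd_sum_addb; congr odd.
apply: eq_bigr => -[a b] _ /=; rewrite /f !perm_word_perm !permM.
by do 2!case: odd_index => //=; rewrite addbA addbK.
Qed.

Lemma odd_inversions1 (m n r : nat) (w : word m n r) :
  odd (odd_inversions 1%g w) = false.
Proof.
by have := odd_inversionsM 1%g 1%g w; rewrite mulg1 perm_word1 addbb.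
Qed.

Lemma odd_inversionsV (m n r : nat) (s : 'S_r) (w : word m n r) :
  odd (odd_inversions s^-1%g (perm_word s w)) = odd (odd_inversions s w).
Proof.
have := odd_inversionsM s s^-1%g w; rewrite mulgV odd_inversions1.
by move/esym/addbP; case: odd; case: odd.
Qed.

Lemma inversion_adjacent (r : nat) (x y a b : 'I_r) : x.+1 = y ->
  (a < b)%N && (tperm x y b < tperm x y a)%N = ((a, b) == (x, y)).
Proof.
move=> def_y; have val_t z : tperm x y z =
    (if (z == x :> nat) then x.+1 else if (z == x.+1 :> nat) then x : nat else z)
      :> nat.
  rewrite def_y; case: tpermP => [->|->|/eqP + /eqP]; rewrite ?eqxx //.
    by rewrite -def_y; case: eqP => //; lia.
  by rewrite -!val_eqE /= => /negPf-> /negPf->.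
rewrite xpair_eqE -!val_eqE /= !val_t -def_y.
by case: (a =P x :> nat); case: (a =P x.+1 :> nat);
   case: (b =P x :> nat); case: (b =P x.+1 :> nat); lia.
Qed.

Lemma odd_inversions_adjacent (m n r : nat) (w : word m n r) (x y : 'I_r) :
  x.+1 = y ->
  odd_inversions (tperm x y) w = (odd_index (w x) && odd_index (w y)) :> nat.
Proof.
move=> def_y; rewrite /odd_inversions.
case: (boolP (_ && _)) => oxy.
  rewrite (_ : [set _ | _] = [set (x, y)]) ?cards1 //.
  apply/setP => -[a b]; rewrite !inE /= andbA inversion_adjacent //.
  by case: eqP => // -[-> ->].
rewrite (_ : [set _ | _] = set0) ?cards0 //.
apply/setP => -[a b]; rewrite !inE /= andbA inversion_adjacent //.
by case: eqP => // -[-> ->]; rewrite (negPf oxy).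
Qed.

(** By conjugation the two positions may be taken to be 0 and 1, which avoids
counting the odd letters between them. *)
Lemma odd_inversions_tperm (m n r : nat) (w : word m n r) (x y : 'I_r) :
  x != y -> w x = w y -> odd (odd_inversions (tperm x y) w) = odd_index (w x).
Proof.
move=> neq_xy eq_w; case: (boolP (odd_index (w x))) => [ox | ex]; last first.
  rewrite /odd_inversions (_ : [set _ | _] = set0) ?cards0 //.
  apply/setP => -[a b]; rewrite !inE /=; apply/negP => /and4P[lt_ab lt_t oa ob].
  have fix_odd z : odd_index (w z) -> tperm x y z = z.
    by case: tpermP ex => // [->|->] => [/negPf->|]; rewrite // eq_w => /negPf->.
  by move: lt_t; rewrite !fix_odd // ltnNge ltnW.
have r_gt1 : (1 < r)%N.
  by move: neq_xy (ltn_ord x) (ltn_ord y); rewrite -val_eqE /=; lia.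
pose i0 := Ordinal (ltnW r_gt1); pose i1 := Ordinal r_gt1.
have [s [sx sy]] : exists s : 'S_r, s x = i0 /\ s y = i1.
  exists (tperm x i0 * tperm (tperm x i0 y) i1)%g; rewrite !permM !tpermL.
  split=> //; apply: tpermD => //.
  by rewrite -[X in _ != X](tpermL x i0) (inj_eq perm_inj) eq_sym.
have inv01 : odd_inversions (tperm i0 i1) (perm_word s w) = 1%N.
  by rewrite odd_inversions_adjacent // -sx -sy !perm_word_perm -eq_w ox.
have := odd_inversionsM (tperm x y) s w; rewrite tpermM_swap sx sy.
rewrite odd_inversionsM inv01 (_ : perm_word (tperm x y) w = w); last first.
  by apply/eqP/perm_word_id => z; case: tpermP => // ->.
by case: (odd (odd_inversions s w)) => /=; case: odd.
Qed.

(** * The kernel of Phi and faithfulness in characteristic zero *)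

(** X_w applied to f, evaluated at g. *)
Definition stab_sum (R : pzRingType) (m n r : nat) (w : word m n r)
    (f : 'S_r -> R) (g : 'S_r) : R :=
  \sum_(h | perm_word h w == w) (-1) ^+ odd_inversions h w * f (g * h)%g.

Lemma signr_odd_eq (R : pzRingType) (a b : nat) :
  odd a = odd b -> (-1) ^+ a = (-1) ^+ b :> R.
Proof. by move=> eq_ab; rewrite -signr_odd eq_ab signr_odd. Qed.

Lemma signr_odd_add (R : pzRingType) (a b c : nat) :
  odd a = odd b (+) odd c -> (-1) ^+ a = (-1) ^+ b * (-1) ^+ c :> R.
Proof. by move=> eq_ab; rewrite -signr_odd eq_ab signr_addb !signr_odd. Qed.

Lemma perm_wordK (m n r : nat) (s : 'S_r) :
  cancel (@perm_word m n r s) (@perm_word m n r s^-1%g).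
Proof. by move=> w; rewrite -perm_wordM mulgV perm_word1. Qed.

(** Inversion turns the left translations by the stabilizer, which appear in the
coefficient of a basis vector, into right translations. *)
Lemma Phi_kernelP (k : fieldType) (m n r : nat) (a : 'S_r -> k) :
  Phi k m n r [ffun s => a s^-1%g] = 0 <->
  forall (w : word m n r) g, stab_sum w a g = 0.
Proof.
have E (w : word m n r) g :
    \sum_s ([ffun s => a s^-1%g] s : k) * ((-1) ^+ odd_inversions s w *
       (perm_word g^-1%g w == perm_word s w)%:R) =
    (-1) ^+ odd_inversions g^-1%g w * stab_sum w a g.
  rewrite /stab_sum mulr_sumr [RHS]big_mkcond /=.
  rewrite (reindex_inj (@invg_inj _)) (reindex_inj (mulgI g)) /=.
  apply: eq_bigr => h _; rewrite ffunE invgK invMg perm_wordM.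
  rewrite (inj_eq (can_inj (@perm_wordK _ _ _ _))).
  have -> : (w == perm_word h^-1%g w) = (perm_word h w == w).
    by rewrite -(inj_eq (can_inj (perm_wordK h))) -perm_wordM mulVg perm_word1 eq_sym.
  case: eqP => [hw | _]; last by rewrite !mulr0.
  have -> : (-1) ^+ odd_inversions (h^-1 * g^-1)%g w =
      (-1) ^+ odd_inversions g^-1%g w * (-1) ^+ odd_inversions h w :> k.
    apply: signr_odd_add; rewrite odd_inversionsM addbC; congr (_ (+) _).
      by rewrite -{1}hw perm_wordK.
    by rewrite -{1}hw odd_inversionsV.
  by rewrite mulr1 mulrC mulrA.
rewrite Phi0P; split=> [a0 w g | a0 w u].
  by have /eqP := E w g; rewrite a0 eq_sym mulf_eq0 signr_eq0 => /eqP.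
have [/existsP[g /eqP->] | /existsPn noperm] :=
    boolP [exists g : 'S_r, u == perm_word g^-1%g w].
  by rewrite E a0 mulr0.
apply: big1 => s _; have := noperm s^-1%g; rewrite invgK => /negPf->.
by rewrite !mulr0.
Qed.

Lemma stab_sumD (R : comPzRingType) (m n r : nat) (I : Type) (s : seq I)
    (P : pred I) (w : word m n r) (f : 'S_r -> R) (c : R)
    (F : I -> 'S_r -> R) (g : 'S_r) :
  stab_sum w (fun h => f h + c * \sum_(i <- s | P i) F i h) g =
    stab_sum w f g + c * \sum_(i <- s | P i) stab_sum w (F i) g.
Proof.
rewrite /stab_sum exchange_big mulr_sumr -big_split; apply: eq_bigr => h _.
by rewrite mulrDr mulrCA mulr_sumr.
Qed.

Lemma stab_sum_tperm (R : comPzRingType) (m n r : nat) (w : word m n r)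
    (f : 'S_r -> R) (g : 'S_r) x y : x != y -> w x = w y ->
  stab_sum w (fun h => f (h * tperm x y)%g) g =
    (-1) ^+ odd_index (w x) * stab_sum w f g.
Proof.
move=> neq_xy eq_w; rewrite /stab_sum [RHS]mulr_sumr.
rewrite [RHS](reindex_inj (mulIg (tperm x y))) /=.
have tw : perm_word (tperm x y) w = w.
  by apply/eqP/perm_word_id => z; case: tpermP => // ->.
apply: eq_big => [h | h /eqP hw].
  by rewrite perm_wordM -[X in _ = (_ == X)]tw (inj_eq (can_inj (perm_wordK _))).
rewrite mulrA mulgA -(odd_inversions_tperm neq_xy eq_w) signr_odd -exprD.
congr (_ * _); apply: signr_odd_eq.
by rewrite oddD odd_inversionsM hw addbCA addbb addbF.
Qed.

(** Right translation permutes the operators X_w, so the functions that they all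
kill form a submodule. *)
Lemma stab_sum_translate (R : pzRingType) (m n r : nat) (w : word m n r)
    (f : 'S_r -> R) (g t : 'S_r) :
  stab_sum w (fun h => f (h * t)%g) g = stab_sum (perm_word t w) f (g * t)%g.
Proof.
rewrite /stab_sum [RHS](reindex_inj (conjg_inj t)) /=.
have conj h : perm_word (h ^ t)%g (perm_word t w) = perm_word t (perm_word h w).
  by rewrite -!perm_wordM -conjgC.
apply: eq_big => [h | h /eqP hw].
  by rewrite conj (inj_eq (can_inj (perm_wordK t))).
rewrite -!mulgA -conjgC; congr (_ * _); apply: signr_odd_eq.
have := odd_inversionsM h t w; rewrite conjgC odd_inversionsM hw.
by case: odd; case: odd; case: odd.
Qed.

Lemma stab_sum_kernel_closed (R : comPzRingType) (m n r : nat)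
    (K := fun f : 'S_r -> R => forall (w : word m n r) g, stab_sum w f g = 0) :
  (forall B f, K f -> K (antisymmetrize B f)) /\
  (forall b D c f, K f -> K (adjoin b D c f)).
Proof.
split=> [B f Kf w g | b D c f Kf w g].
  rewrite /stab_sum /antisymmetrize; under eq_bigr => h _ do rewrite mulr_sumr.
  rewrite exchange_big big1 //= => s _.
  have := stab_sum_translate w f g s; rewrite Kf /stab_sum => eq0.
  rewrite -[RHS](mulr0 ((-1) ^+ s)) -[X in _ * X]eq0 mulr_sumr.
  by apply: eq_bigr => h _; rewrite mulrCA.
rewrite /adjoin stab_sumD Kf big1 ?mulr0 ?addr0 // => q _.
by rewrite stab_sum_translate Kf.
Qed.

(** The sum X_w acts on the vector provided by [hook_word_exists] as the order of
the stabilizer, which is nonzero. *)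
Lemma Phi_injective_char0 (F : numFieldType) (m n r : nat) :
  (r < m.+1 * n.+1)%N -> injective (Phi F m n r).
Proof.
move=> lt_r; apply: raddf_inj => a Phi_a0; apply/ffunP => s; rewrite ffunE.
pose f (s : 'S_r) := a s^-1%g : F.
pose K (f : 'S_r -> F) := forall (w : word m n r) g, stab_sum w f g = 0.
have Kf : K f.
  apply/Phi_kernelP; rewrite -[RHS]Phi_a0; congr (Phi _ _ _ _ _).
  by apply/ffunP => t; rewrite ffunE /f invgK.
apply/eqP; apply/negPn/negP => as_neq0.
have [closedY closedA] := stab_sum_kernel_closed F m n r.
have [||||w [v [Kv [g vg] sym_v]]] := @hook_word_exists F _ m n K f closedY.
- by move=> D c h; apply: closedA.
- by rewrite card_ord.
- exact: Kf.
- by exists s^-1%g; rewrite /f invgK.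
pose w' : word m n r := [ffun i => w i].
have stab_v h : perm_word h w' == w' ->
    forall g, v (g * h)%g = (-1) ^+ odd_inversions h w' * v g.
  move/perm_word_id; move: h.
  apply: (@preserving_perm_ind _ _ w' (fun h => forall g,
      v (g * h)%g = (-1) ^+ odd_inversions h w' * v g)) => [g0 | x y h neq_xy eq_w _ IH g0].
    by rewrite mulg1 -signr_odd odd_inversions1 mul1r.
  rewrite mulgA IH sym_v //; last by move: eq_w; rewrite !ffunE.
  rewrite mulrA; congr (_ * _); rewrite -exprD; apply: signr_odd_eq.
  rewrite oddD oddb odd_inversionsM odd_inversions_tperm // ffunE addbC.
  by rewrite (_ : perm_word (tperm x y) w' = w') //; apply/eqP/perm_word_id => z;
     case: tpermP => // ->.
have /eqP := Kv w' g; rewrite /stab_sum (eq_bigr (fun _ => v g)); last first.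
  by move=> h hw; rewrite stab_v // mulrA -expr2 sqrr_sign mul1r.
rewrite sumr_const -mulr_natl mulf_eq0 (negPf vg) orbF pnatr_eq0 -leqn0 leqNgt.
by case/negP; apply/card_gt0P; exists 1%g; exact: (introT eqP (perm_word1 w')).
Qed.

(** * Integer linear systems in two characteristics *)

(** A nonzero minor over k is the image of a nonzero integer. *)
Lemma rank_map_int_le (k : fieldType) (p q : nat) (A : 'M[int]_(p, q)) :
  (\rank (map_mx intr A : 'M[k]_(p, q)) <=
   \rank (map_mx intr A : 'M[rat]_(p, q)))%N.
Proof.
set Ak : 'M[k]_(p, q) := map_mx intr A; set AQ : 'M[rat]_(p, q) := map_mx intr A.
pose f := maxrankfun Ak.
have full_f : row_full (rowsub f Ak)^T.
  by rewrite /row_full mxrank_tr (eqP (maxrowsub_free Ak)).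
pose g := fullrankfun full_f.
have unit_k : mxsub f g Ak \in unitmx.
  rewrite -unitmx_tr -row_free_unit trmx_mxsub /row_free.
  have -> : mxsub g f Ak^T = rowsub g (rowsub f Ak)^T.
    by apply/matrixP => i j; rewrite !mxE.
  by rewrite mxrank_fullrowsub.
have unit_Q : mxsub f g AQ \in unitmx.
  rewrite unitmxE -map_mxsub det_map_mx unitfE intr_eq0.
  apply: contraTneq unit_k => det0.
  by rewrite unitmxE -map_mxsub det_map_mx det0 rmorph0 unitr0.
have <- : \rank (mxsub f g AQ) = \rank Ak by apply: mxrank_unit.
have -> : mxsub f g AQ = rowsub f (rowsub g AQ^T)^T.
  by apply/matrixP => i j; rewrite !mxE.
apply: leq_trans (mxrankS (rowsub_sub _ _)) _.
by rewrite mxrank_tr -(mxrank_tr AQ) mxrankS ?rowsub_sub.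
Qed.

(** The rows of B are solutions of the system A.  Over the rationals they are
independent, so the solution space has dimension at least #|D|; by
[rank_map_int_le] it is at least as large over k.  If the rows of B span it over
k, they must stay independent there. *)
Lemma commutant_transfer (k : fieldType) (D I J : finType)
    (B : D -> I -> int) (A : I -> J -> int) :
  (forall d j, \sum_i B d i * A i j = 0) ->
  (forall a : D -> rat, (forall i, \sum_d a d * (B d i)%:~R = 0) ->
     forall d, a d = 0) ->
  (forall x : I -> k, (forall j, \sum_i x i * (A i j)%:~R = 0) ->
     exists c : D -> k, forall i, x i = \sum_d c d * (B d i)%:~R) ->
  forall a : D -> k, (forall i, \sum_d a d * (B d i)%:~R = 0) ->
    forall d, a d = 0.
Proof.
move=> BA0 freeQ span a Ba0.
pose MB : 'M[int]_(#|D|, #|I|) := \matrix_(d, i) B (enum_val d) (enum_val i).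
pose MA : 'M[int]_(#|I|, #|J|) := \matrix_(i, j) A (enum_val i) (enum_val j).
have sumE (R : pzRingType) (T : finType) (F : T -> R) :
    \sum_(i < #|T|) F (enum_val i) = \sum_i F i.
  by rewrite [RHS](reindex (@enum_val T T)) //; apply: onW_bij; apply: enum_val_bij.
have row0_eq (F : fieldType) (u : 'rV[F]_#|D|) : u *m map_mx intr MB = 0 ->
    forall i, \sum_d u 0 (enum_rank d) * (B d i)%:~R = 0 :> F.
  move=> uB i; have /matrixP/(_ 0 (enum_rank i)) := uB.
  rewrite mxE [RHS]mxE => eq0; rewrite -[RHS]eq0 -[LHS]sumE.
  by apply: eq_bigr => d _; rewrite !mxE enum_valK enum_rankK.
have MBA : MB *m MA = 0.
  apply/matrixP => d j; rewrite !mxE -[RHS](BA0 (enum_val d) (enum_val j)).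
  rewrite -[RHS]sumE.
  by apply: eq_bigr => i _; rewrite !mxE.
have freeBQ : row_free (map_mx intr MB : 'M[rat]_(_, _)).
  rewrite -kermx_eq0; apply/eqP/row_matrixP => i; rewrite row0.
  set u := row i _; have /row0_eq uB : u *m map_mx intr MB = 0.
    by rewrite -row_mul mulmx_ker row0.
  apply/rowP => d; rewrite [RHS]mxE -[d]enum_valK.
  exact: (freeQ (fun d => u 0 (enum_rank d))).
have leD : (#|D| <= \rank (kermx (map_mx intr MA : 'M[k]_(_, _))))%N.
  rewrite mxrank_ker; apply: leq_trans (leq_sub2l _ (rank_map_int_le k MA)).
  rewrite -mxrank_ker -{1}(eqP freeBQ) mxrankS //; apply/sub_kermxP.
  by rewrite -map_mxM MBA map_mx0.
have freeBk : row_free (map_mx intr MB : 'M[k]_(_, _)).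
  rewrite /row_free eqn_leq rank_leq_row (leq_trans leD) // mxrankS //.
  apply/row_subP => i; set u := row i _.
  have uA : u *m map_mx intr MA = 0 by rewrite -row_mul mulmx_ker row0.
  have [j | c uE] := span (fun i => u 0 (enum_rank i)).
    have /matrixP/(_ 0 (enum_rank j)) := uA; rewrite mxE [RHS]mxE => eq0; rewrite -[RHS]eq0 -[LHS]sumE.
    by apply: eq_bigr => d _; rewrite !mxE enum_valK enum_rankK.
  apply/submxP; exists (\row_d c (enum_val d)); apply/rowP => j.
  rewrite -[j in LHS]enum_valK uE mxE -[LHS]sumE.
  by apply: eq_bigr => d _; rewrite !mxE.
move=> d; pose u : 'rV[k]_#|D| := \row_d a (enum_val d).
suff /rowP/(_ (enum_rank d)) : u = 0 by rewrite !mxE enum_rankK.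
apply: (row_free_inj freeBk); rewrite mul0mx; apply/rowP => i.
rewrite mxE [RHS]mxE -[RHS](Ba0 (enum_val i)).
rewrite -[RHS]sumE.
by apply: eq_bigr => e _; rewrite !mxE.
Qed.

(** * The action of GL(m|n) and the symmetric group *)

(** The transposition of x and y is conjugate to that of x and y - 1 by an
adjacent one. *)
Lemma adjacent_perm_ind (r : nat) (P : 'S_r -> Prop) :
  P 1%g -> (forall s t, P s -> P t -> P (s * t)%g) ->
  (forall x y : 'I_r, x.+1 = y -> P (tperm x y)) -> forall s, P s.
Proof.
move=> P1 PM Padj.
have Plt d (x y : 'I_r) : (x + d.+1 = y)%N -> P (tperm x y).
  elim: d x y => [|d IHd] x y eq_y; first by apply: Padj; lia.
  have lt_z : (x + d.+1 < r)%N by have := ltn_ord y; lia.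
  pose z := Ordinal lt_z.
  have Pzy : P (tperm z y) by apply: Padj => /=; lia.
  have <- : (tperm x z ^ tperm z y)%g = tperm x y.
    by rewrite tpermJ tpermL tpermD // -val_eqE /=; lia.
  by rewrite conjgE tpermV; apply: (PM) => //; apply: (PM) => //; apply: IHd.
move=> s; have [ts -> _] := prod_tpermP s; elim/big_rec: _ => // -[x y] t _ Pt.
apply: PM => //=; case: (ltngtP x y) => [lt_xy | lt_yx | /val_inj->].
- by apply: (Plt (y - x).-1); lia.
- by rewrite tpermC; apply: (Plt (x - y).-1); lia.
by rewrite tperm1.
Qed.

Lemma prod_adjacent (R : pzRingType) (r : nat) (F : 'I_r -> R) (x y : 'I_r) :
  x.+1 = y -> exists L M : R,
    \prod_(a < r) F a = L * (F x * F y) * M /\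
    \prod_(a < r) F (tperm x y a) = L * (F y * F x) * M.
Proof.
move=> def_y.
have natE (G : 'I_r -> R) : \prod_(a < r) G a = \prod_(0 <= a < r) G (insubd x a).
  by rewrite big_mkord; apply: eq_bigr => a _; rewrite valKd.
have split (G : 'I_r -> R) : \prod_(a < r) G a =
    \prod_(0 <= a < x) G (insubd x a) * (G x * G y) *
    \prod_(y.+1 <= a < r) G (insubd x a).
  rewrite natE (@big_cat_nat _ _ _ x) //=; last exact: ltnW.
  rewrite -mulrA; congr (_ * _); rewrite big_ltn // def_y big_ltn //.
  by rewrite -def_y valKd def_y valKd mulrA.
exists (\prod_(0 <= a < x) F (insubd x a)),
  (\prod_(y.+1 <= a < r) F (insubd x a)).
split; rewrite split // tpermL tpermR; congr (_ * _ * _);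
  apply: eq_big_nat => a /andP[lea lta]; congr F; apply: tpermD;
  rewrite -val_eqE val_insubd /=; move: (ltn_ord y) (ltn_ord x); case: ifP; lia.
Qed.

(** The operators of S_r and of GL(m|n) commute.  For an adjacent transposition,
exchanging two neighbouring entries of g in the product costs a sign by
supercommutativity, and moving the entries past the basis vectors in the other
order costs another; the two combine to the signs of the action on u and on
w. *)
Lemma GL_coef_perm (k : fieldType) (m n r : nat) (R : superAlgebra k)
    (g : 'M[R]_(m + n)) (s : 'S_r) (u w : word m n r) :
  in_GL g ->
  GL_coef g (perm_word s u) (perm_word s w) =
    (-1) ^+ (odd_inversions s u + odd_inversions s w) * GL_coef g u w.
Proof.
case=> hom_g _; move: s u w.
apply: adjacent_perm_ind => [u w | s t IHs IHt u w | x y def_y u w].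
- by rewrite !perm_word1 -signr_odd oddD !odd_inversions1 mul1r.
- rewrite !perm_wordM IHt IHs mulrA -exprD; congr (_ * _); apply: signr_odd_eq.
  by rewrite !oddD !odd_inversionsM; do 4!case: odd.
have neq_xy : x != y by rewrite -val_eqE /=; lia.
have permE (v : word m n r) a : perm_word (tperm x y) v a = v (tperm x y a).
  by rewrite ffunE tpermV.
pose p a := odd_index (u a) (+) odd_index (w a).
pose f (a b : 'I_r) : nat := p a && odd_index (u b).
have [L [M [prodE prodtE]]] := prod_adjacent (fun a => g (u a) (w a)) def_y.
rewrite /GL_coef prodE.
rewrite (eq_bigr (fun a => g (u (tperm x y a)) (w (tperm x y a)))); last first.
  by move=> a _; rewrite !permE.
rewrite prodtE (sa_supercomm (hom_g (u y) (w y)) (hom_g (u x) (w x))).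
set b := _ && _; have commL z : L * ((-1) ^+ b * z) * M = (-1) ^+ b * (L * z * M).
  by case: (b); rewrite !(mul1r, mulN1r, mulrN, mulNr).
rewrite commL !mulrA -!exprD -!mulrA; congr (_ * _); apply: signr_odd_eq.
(* Reindexing by the transposition preserves the order of all pairs of positions
   but the pair x, y. *)
pose rest := (\sum_(ab : 'I_r * 'I_r | (ab.1 < ab.2)%N && (ab != (x, y))) f ab.1 ab.2)%N.
have sum_lt : (\sum_(a < r) \sum_(b < r | (a < b)%N) f a b = f x y + rest)%N.
  by rewrite pair_big_dep /= (bigD1 (x, y)) //= -def_y.
have sum_tlt : (\sum_(a < r) \sum_(b < r | (a < b)%N)
    f (tperm x y a) (tperm x y b) = f y x + rest)%N.
  rewrite pair_big_dep /= (bigD1 (x, y)) /= -?def_y // tpermL tpermR.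
  congr (_ + _)%N; rewrite /rest.
  rewrite [RHS](reindex_inj (h := fun ab => (tperm x y ab.1, tperm x y ab.2))) /=; last first.
    by move=> [a c] [a' c'] [/perm_inj-> /perm_inj->].
  apply: eq_bigl => -[a c] /=; rewrite -!inversion_adjacent // !tpermK.
  have [->|neq_ac] := eqVneq a c; first by rewrite !ltnn.
  rewrite (ltn_ord_neg neq_ac) (@ltn_ord_neg _ (tperm x y a)) ?(inj_eq perm_inj) //.
  by case: (a < c)%N; case: (tperm x y a < tperm x y c)%N.
have -> : (\sum_(a < r) \sum_(b < r | (a < b)%N)
   ((odd_index (perm_word (tperm x y) u a) (+)
     odd_index (perm_word (tperm x y) w a)) &&
     odd_index (perm_word (tperm x y) u b)))%N = (f y x + rest)%N.
  rewrite -sum_tlt; apply: eq_bigr => a _; apply: eq_bigr => c _.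
  by rewrite !permE.
have -> : (\sum_(a < r) \sum_(b < r | (a < b)%N)
   ((odd_index (u a) (+) odd_index (w a)) && odd_index (u b)))%N = (f x y + rest)%N.
  exact: sum_lt.
rewrite !oddD !odd_inversions_adjacent // !oddb /f /p /b.
by do 4!case: odd_index; case: (odd rest).
Qed.

(** * Orbit matrices and surjectivity *)

Definition word_pair (m n r : nat) := (word m n r * word m n r)%type.

Definition perm_pair (m n r : nat) (s : 'S_r) (x : word_pair m n r) :
  word_pair m n r := (perm_word s x.1, perm_word s x.2).

Definition pair_inversions (m n r : nat) (s : 'S_r) (x : word_pair m n r) : nat :=
  (odd_inversions s x.1 + odd_inversions s x.2)%N.

Lemma perm_pairM (m n r : nat) (s t : 'S_r) (x : word_pair m n r) :
  perm_pair (s * t)%g x = perm_pair t (perm_pair s x).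
Proof. by rewrite /perm_pair !perm_wordM. Qed.

Lemma perm_pair1 (m n r : nat) (x : word_pair m n r) : perm_pair 1%g x = x.
Proof. by rewrite /perm_pair !perm_word1; case: x. Qed.

Lemma odd_pair_inversionsM (m n r : nat) (s t : 'S_r) (x : word_pair m n r) :
  odd (pair_inversions (s * t)%g x) =
    odd (pair_inversions s x) (+) odd (pair_inversions t (perm_pair s x)).
Proof. by rewrite !oddD !odd_inversionsM addbACA. Qed.

(** [pick] depends only on the extension of its predicate, hence on the orbit. *)
Definition orbit_rep (m n r : nat) (x : word_pair m n r) : word_pair m n r :=
  odflt x [pick y | [exists s, perm_pair s x == y]].

Lemma orbit_repP (m n r : nat) (x : word_pair m n r) :
  exists s, perm_pair s (orbit_rep x) = x.
Proof.
rewrite /orbit_rep; case: pickP => [y /existsP[s /eqP <-] | _] /=.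
  by exists s^-1%g; rewrite -perm_pairM mulgV perm_pair1.
by exists 1%g; rewrite perm_pair1.
Qed.

Lemma orbit_rep_perm (m n r : nat) (s : 'S_r) (x : word_pair m n r) :
  orbit_rep (perm_pair s x) = orbit_rep x.
Proof.
rewrite /orbit_rep (eq_pick (Q := fun y => [exists s, perm_pair s x == y])).
  case: pickP => // /(_ x)/existsP[]; exists 1%g; exact/eqP/perm_pair1.
move=> y; apply/existsP/existsP => -[t /eqP <-].
  by exists (s * t)%g; rewrite perm_pairM.
by exists (s^-1 * t)%g; rewrite -perm_pairM mulKVg.
Qed.

(** On such an orbit an S_r-equivariant coefficient equals its opposite. *)
Definition null_orbit (m n r : nat) (x : word_pair m n r) : bool :=
  [exists s, (perm_pair s x == x) && odd (pair_inversions s x)].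

(** The signed indicator function of the orbit of o, or zero if o is not a chosen
representative or its orbit admits no consistent sign.  These functions form a
basis of the equivariant matrices in every characteristic other than 2. *)
Definition orbit_coef (m n r : nat) (o x : word_pair m n r) : int :=
  if null_orbit o || (orbit_rep x != o) then 0 else
  if [pick s | perm_pair s o == x] is Some s then (-1) ^+ pair_inversions s o
  else 0.

Lemma orbit_coefE (m n r : nat) (o x : word_pair m n r) (s : 'S_r) :
  ~~ null_orbit o -> orbit_rep x = o -> perm_pair s o = x ->
  orbit_coef o x = (-1) ^+ pair_inversions s o.
Proof.
move=> nnull rep_x so; rewrite /orbit_coef (negPf nnull) rep_x eqxx /=.
case: pickP => [t /eqP to | /(_ s)/eqP//]; apply: signr_odd_eq; apply/eqP.
have st_o : perm_pair (s * t^-1)%g o = o.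
  by rewrite perm_pairM so -to -perm_pairM mulgV perm_pair1.
move/existsPn/(_ (s * t^-1)%g): nnull; rewrite st_o eqxx /=.
have := odd_pair_inversionsM (s * t^-1)%g t o; rewrite mulgKV st_o => ->.
by case: odd => //=; case: odd.
Qed.

Lemma orbit_coef_perm (m n r : nat) (o x : word_pair m n r) (s : 'S_r) :
  orbit_coef o (perm_pair s x) = (-1) ^+ pair_inversions s x * orbit_coef o x.
Proof.
have [null | nnull] := boolP (null_orbit o); first by rewrite /orbit_coef null mulr0.
have [rep_x | rep_x] := eqVneq (orbit_rep x) o; last first.
  by rewrite /orbit_coef orbit_rep_perm rep_x orbT mulr0.
have [t] := orbit_repP x; rewrite rep_x => to.
rewrite (orbit_coefE nnull rep_x to) (@orbit_coefE _ _ _ _ _ (t * s)%g) //.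
- by rewrite -exprD; apply: signr_odd_eq; rewrite oddD odd_pair_inversionsM to addbC.
- by rewrite orbit_rep_perm.
by rewrite perm_pairM to.
Qed.

(** The action of g is a combination, with coefficients in R, of integer matrices
that do not depend on g. *)
Lemma GL_coef_orbit (k : fieldType) (m n r : nat) (R : superAlgebra k)
    (g : 'M[R]_(m + n)) (u w : word m n r) :
  2%:R != 0 :> k -> in_GL g ->
  GL_coef g u w =
    \sum_(o : word_pair m n r) (orbit_coef o (u, w))%:~R *: GL_coef g o.1 o.2.
Proof.
move=> two_neq0 gP; rewrite (bigD1 (orbit_rep (u, w))) //= big1 ?addr0; last first.
  by move=> o neq_o; rewrite /orbit_coef eq_sym neq_o orbT scale0r.
have [s so] := orbit_repP (u, w); set o := orbit_rep _ in so *.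
have GE : GL_coef g u w = (-1) ^+ pair_inversions s o * GL_coef g o.1 o.2.
  by rewrite -GL_coef_perm //; case: so => <- <-.
have [null | nnull] := boolP (null_orbit o); last first.
  rewrite (orbit_coefE nnull _ so) // GE rmorphXn rmorphN1 /=.
  by rewrite -signr_odd -[in RHS]signr_odd; case: odd;
     rewrite ?expr1 ?expr0 ?mulN1r ?mul1r ?scaleN1r ?scale1r.
rewrite /orbit_coef null scale0r GE.
case/existsP: null => t /andP[/eqP to odd_t].
have [to1 to2] : perm_word t o.1 = o.1 /\ perm_word t o.2 = o.2.
  by split; rewrite -[in RHS]to.
have : GL_coef g o.1 o.2 = - GL_coef g o.1 o.2.
  have := GL_coef_perm t o.1 o.2 gP; rewrite to1 to2 -signr_odd.
  by rewrite -/(pair_inversions t o) odd_t expr1 mulN1r.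
move/eqP; rewrite -addr_eq0 -mulr2n -scaler_nat scaler_eq0 (negPf two_neq0) /=.
by move/eqP->; rewrite mulr0.
Qed.

Definition coef_sum (k : fieldType) (m n r : nat) (x : word_pair m n r -> k)
    (t : tens k m n r) : tens k m n r :=
  [ffun u => \sum_w x (u, w) * (t w : k)].

Fact coef_sum_is_linear (k : fieldType) (m n r : nat) (x : word_pair m n r -> k) :
  linear (coef_sum x).
Proof.
move=> c t t'; apply/ffunP => u; rewrite !ffunE.
rewrite scaler_sumr -big_split; apply: eq_bigr => w _.
by rewrite !ffunE /GRing.scale /= mulrDr mulrCA.
Qed.

HB.instance Definition _ (k : fieldType) (m n r : nat) (x : word_pair m n r -> k) :=
  GRing.isLinear.Build k (tens k m n r) (tens k m n r) _ (coef_sum x)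
    (coef_sum_is_linear x).

Lemma coef_sum_basis (k : fieldType) (m n r : nat) (x : word_pair m n r -> k)
    (u w : word m n r) :
  linfun (coef_sum x) (basis_tens k w) u = x (u, w).
Proof.
rewrite lfunE ffunE (bigD1 w) //= ffunE eqxx mulr1 big1 ?addr0 // => v neq_vw.
by rewrite ffunE (negPf neq_vw) mulr0.
Qed.

Lemma End_GL_coef_sum (k : fieldType) (m n r : nat) (x : word_pair m n r -> k) :
  2%:R != 0 :> k ->
  (forall u w, x (u, w) != 0 -> odd_word u = odd_word w) ->
  (forall o u v, \sum_w x (u, w) * (orbit_coef o (w, v))%:~R =
                 \sum_w x (w, v) * (orbit_coef o (u, w))%:~R) ->
  End_GL (linfun (coef_sum x)).
Proof.
move=> two_neq0 even_x comm_x; split=> [b t hom_t u | R g gP t].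
  rewrite lfunE ffunE => sum_neq0.
  have [w xtw] : exists w, x (u, w) * (t w : k) != 0.
    apply/existsP; apply: contraNT sum_neq0 => /existsPn all0.
    by rewrite big1 // => w _; apply/eqP; have := all0 w; rewrite negbK.
  by move: xtw; rewrite mulf_eq0 negb_or => /andP[/even_x-> /hom_t].
have commG u v : \sum_w x (u, w) *: GL_coef g w v =
                 \sum_w x (w, v) *: GL_coef g u w.
  under eq_bigr => w _ do rewrite (GL_coef_orbit _ _ two_neq0 gP) scaler_sumr.
  under [in RHS]eq_bigr => w _ do rewrite (GL_coef_orbit _ _ two_neq0 gP) scaler_sumr.
  rewrite exchange_big [RHS]exchange_big; apply: eq_bigr => o _ /=.
  under eq_bigr => w _ do rewrite scalerA.
  under [in RHS]eq_bigr => w _ do rewrite scalerA.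
  by rewrite -!scaler_suml comm_x.
apply/ffunP => u; rewrite !ffunE.
transitivity (\sum_v (\sum_w x (u, w) *: GL_coef g w v) * t v).
  under eq_bigr => w _ do rewrite coef_sum_basis ffunE scaler_sumr.
  rewrite exchange_big; apply: eq_bigr => v _ /=; rewrite mulr_suml.
  by apply: eq_bigr => w _; rewrite scalerAl.
under eq_bigr => v _ do rewrite commG mulr_suml.
rewrite exchange_big; apply: eq_bigr => w _ /=; rewrite ffunE mulr_sumr.
by apply: eq_bigr => v _; rewrite coef_sum_basis -scalerAl -scalerAr.
Qed.

Definition perm_coef (m n r : nat) (s : 'S_r) (x : word_pair m n r) : int :=
  (-1) ^+ odd_inversions s x.2 * (x.1 == perm_word s x.2)%:R.

Lemma Phi_coef (k : fieldType) (m n r : nat) (a : group_algebra k r)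
    (u w : word m n r) :
  (Phi k m n r a (basis_tens k w)) u =
    \sum_s (a s : k) * (perm_coef s (u, w))%:~R :> k.
Proof.
have E s : ((a s : k) *: perm_tens s (basis_tens k w) : tens k m n r) u =
    (a s : k) * (perm_coef s (u, w))%:~R :> k.
  by rewrite perm_tens_basis !ffunE rmorphM rmorphXn rmorphN1 /= rmorph_nat.
rewrite PhiE sum_ffunE.
exact: (@eq_bigr k 0 +%R _ _ _ _ _ (fun s _ => E s)).
Qed.

Lemma Phi_eq0 (k : fieldType) (m n r : nat) (a : group_algebra k r) :
  Phi k m n r a = 0 <->
  forall x : word_pair m n r, \sum_s (a s : k) * (perm_coef s x)%:~R = 0.
Proof.
split=> [a0 [u w] | a0]; first by rewrite -Phi_coef a0 lfunE /= ffunE.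
apply/Phi0P => w u; rewrite -[RHS](a0 (u, w)); apply: eq_bigr => s _.
by rewrite rmorphM rmorphXn rmorphN1 /= rmorph_nat.
Qed.

Lemma perm_coef_commutes (m n r : nat) (s : 'S_r) (o : word_pair m n r)
    (u v : word m n r) :
  \sum_w perm_coef s (u, w) * orbit_coef o (w, v) =
    \sum_w perm_coef s (w, v) * orbit_coef o (u, w).
Proof.
rewrite (bigD1 (perm_word s^-1%g u)) //= [RHS](bigD1 (perm_word s v)) //=.
have su : perm_word s (perm_word s^-1%g u) = u.
  by rewrite -perm_wordM mulVg perm_word1.
rewrite !big1 ?addr0 => [|w neq_w|w neq_w].
- rewrite /perm_coef /= su !eqxx !mulr1.
  have := orbit_coef_perm o (perm_word s^-1%g u, v) s.
  rewrite {1}/perm_pair /= su => ->; rewrite mulrA -exprD; congr (_ * _).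
  apply: signr_odd_eq; rewrite /pair_inversions /= !oddD.
  by do 2!case: odd.
- by rewrite /perm_coef /= (negPf neq_w) mulr0 mul0r.
rewrite /perm_coef /= -[X in X == _]su (inj_eq (can_inj (perm_wordK s))) eq_sym.
by rewrite (negPf neq_w) mulr0 mul0r.
Qed.

Lemma odd_word_perm (m n r : nat) (s : 'S_r) (w : word m n r) :
  odd_word (perm_word s w) = odd_word w.
Proof.
rewrite /odd_word (reindex_inj (@perm_inj _ s)) /=; congr odd.
by apply: eq_bigr => i _; rewrite perm_word_perm.
Qed.

(** The coefficient of the unknown matrix entry x in the equation j.  The equations
on the left express that the matrix commutes with every orbit matrix, those on
the right that it preserves parity. *)
Definition commutant_eqn (m n r : nat) (x : word_pair m n r)
    (j : word_pair m n r * word_pair m n r + word_pair m n r) : int :=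
  match j with
  | inl (o, (u, v)) =>
      (x.1 == u)%:R * orbit_coef o (x.2, v) - (x.2 == v)%:R * orbit_coef o (u, x.1)
  | inr y => (x == y)%:R * (odd_word x.1 (+) odd_word x.2)%:R
  end.

Lemma commutant_eqn_inl (R : comPzRingType) (m n r : nat)
    (x : word_pair m n r -> R) o u v :
  \sum_y x y * (commutant_eqn y (inl (o, (u, v))))%:~R =
    \sum_w x (u, w) * (orbit_coef o (w, v))%:~R -
    \sum_w x (w, v) * (orbit_coef o (u, w))%:~R.
Proof.
transitivity (\sum_a \sum_b x (a, b) *
    (commutant_eqn (a, b) (inl (o, (u, v))))%:~R).
  by rewrite pair_bigA; apply: eq_bigr => -[a b].
rewrite /=.
under eq_bigr => a _ do (under eq_bigr => b _ do rewrite rmorphB /= !rmorphM /= !rmorph_nat mulrBr).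
under eq_bigr => a _ do rewrite big_split /=.
rewrite big_split /= -sumrN; congr (_ + _).
  rewrite (bigD1 u) //= [X in _ + X]big1 ?addr0 => [|a neq_a].
    by apply: eq_bigr => b _; rewrite eqxx mul1r.
  by rewrite big1 // => b _; rewrite (negPf neq_a) mul0r mulr0.
apply: eq_bigr => a _; rewrite (bigD1 v) //= eqxx mul1r big1 ?addr0 // => b neq_b.
by rewrite (negPf neq_b) mul0r mulr0 oppr0.
Qed.

Lemma commutant_eqn_inr (R : comPzRingType) (m n r : nat)
    (x : word_pair m n r -> R) y :
  \sum_z x z * (commutant_eqn z (inr y))%:~R =
    x y * (odd_word y.1 (+) odd_word y.2)%:R.
Proof.
rewrite (bigD1 y) //= eqxx mul1r rmorph_nat big1 ?addr0 // => z neq_z.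
by rewrite (negPf neq_z) mul0r mulr0.
Qed.

(** The matrices of the permutations satisfy the integral system
[commutant_eqn], whose solutions over k lie in the endomorphism algebra and are
thus, by surjectivity, combinations of the same matrices. *)
Lemma Phi_surjective_injective (k : fieldType) (m n r : nat) :
  2%:R != 0 :> k -> (r < m.+1 * n.+1)%N ->
  Phi_surjective k m n r -> injective (Phi k m n r).
Proof.
move=> two_neq0 lt_r surj.
apply: raddf_inj => a /Phi_eq0 a0; apply/ffunP => s; rewrite ffunE.
apply: (commutant_transfer (B := @perm_coef m n r)
  (A := @commutant_eqn m n r) _ _ _ a0 s) => {a a0 s}.
- move=> s j; under eq_bigr => i _ do rewrite -[commutant_eqn i j]intz.
  case: j => [[o [u v]] | [u w]].
    rewrite commutant_eqn_inl; apply/eqP; rewrite subr_eq0; apply/eqP.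
    under eq_bigr => w _ do rewrite intz; under [RHS]eq_bigr => w _ do rewrite intz.
    exact: perm_coef_commutes.
  rewrite commutant_eqn_inr /perm_coef /=.
  by have [-> | _] := eqVneq u _; rewrite ?odd_word_perm ?addbb ?mulr0 ?mul0r.
- move=> a a0 s; pose b : group_algebra rat r := [ffun s => a s].
  suff /ffunP/(_ s) : b = 0 by rewrite !ffunE.
  apply: (Phi_injective_char0 lt_r); rewrite linear0; apply/Phi_eq0 => x.
  by rewrite -[RHS](a0 x); apply: eq_bigr => t _; rewrite ffunE.
move=> x x_sol.
have [|a aE] := surj (linfun (coef_sum x)).
  apply: End_GL_coef_sum => // [u w xuw | o u v].
    have /eqP := x_sol (inr (u, w)); rewrite commutant_eqn_inr mulf_eq0 (negPf xuw).
    by case: odd_word; case: odd_word => //=; rewrite oner_eq0.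
  have /eqP := x_sol (inl (o, (u, v))).
  by rewrite commutant_eqn_inl subr_eq0 => /eqP.
exists (fun s => a s) => -[u w].
by rewrite -Phi_coef aE coef_sum_basis.
Qed.

(** * The module of a near-rectangular partition *)

Lemma pigeonhole_set (T T' : finType) (A : {set T}) (B : {set T'}) (f : T -> T') :
  (forall x, x \in A -> f x \in B) -> (#|B| < #|A|)%N ->
  exists x y, [/\ x \in A, y \in A, x != y & f x = f y].
Proof.
move=> AB ltBA; have /dinjectivePn[x xA [y /andP[neq_yx yA] eq_f]] : ~~ dinjectiveb f A.
  apply: contraL ltBA => /dinjectiveP injf; rewrite -leqNgt -(card_in_imset injf).
  by apply/subset_leq_card/subsetP => _ /imsetP[x xA ->]; apply: AB.
by exists x, y; rewrite eq_sym.
Qed.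

(** A labelling of the points of T by the cells of a partition with m rows, whose
columns 0, ..., n have length m and whose other columns have length 1. *)
Record near_rectangle (T : finType) (m n : nat) (cl rw : T -> nat) : Prop :=
  NearRectangle {
  cell_inj : forall x y, cl x = cl y -> rw x = rw y -> x = y;
  row_lt : forall x, (rw x < m)%N;
  full_column : forall j i, (j <= n)%N -> (i < m)%N -> exists x, cl x = j /\ rw x = i;
  short_column : forall x, (n < cl x)%N -> rw x = 0%N }.

Definition preserves (T : finType) (c : T -> nat) (s : {perm T}) : bool :=
  [forall z, c (s z) == c z].

Lemma preservesP (T : finType) (c : T -> nat) (s : {perm T}) :
  reflect (forall z, c (s z) = c z) (preserves c s).
Proof. exact: 'forall_eqP. Qed.

Lemma preserves1 (T : finType) (c : T -> nat) : preserves c 1%g.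
Proof. by apply/preservesP => z; rewrite perm1. Qed.

Lemma preservesV (T : finType) (c : T -> nat) (s : {perm T}) :
  preserves c s^-1%g = preserves c s.
Proof.
apply/preservesP/preservesP => cs z; first by rewrite -(cs (s z)) permK.
by rewrite -{2}(permKV s z) cs.
Qed.

Lemma preservesMl (T : finType) (c : T -> nat) (s t : {perm T}) :
  preserves c s -> preserves c (s * t)%g = preserves c t.
Proof.
move/preservesP=> cs; apply/preservesP/preservesP => ct z; last by rewrite permM ct cs.
by rewrite -{1}(permKV s z) -permM ct -{2}(permKV s z) cs.
Qed.

Lemma preserves_tperm (T : finType) (c : T -> nat) x y :
  c x = c y -> preserves c (tperm x y).
Proof. by move=> eq_c; apply/preservesP => z; case: tpermP => // ->. Qed.

(** The coefficient of g in the product of the row symmetrizer and the column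
antisymmetrizer. *)
Definition row_column (R : pzRingType) (T : finType) (cl rw : T -> nat)
    (g : {perm T}) : R :=
  \sum_(s | preserves cl s) (-1) ^+ s * (preserves rw (g * s)%g)%:R.

(** The value at g is the scalar product, in the permutation module of the row
stabilizer, of a polytabloid and its translate by g; so the translates of this
function span the quotient of the Specht module by the radical of its form. *)
Definition column_row_column (R : pzRingType) (T : finType) (cl rw : T -> nat)
    (g : {perm T}) : R :=
  \sum_(t | preserves cl t) (-1) ^+ t * row_column R cl rw (t * g)%g.

Lemma row_columnMl (R : pzRingType) (T : finType) (cl rw : T -> nat) s g :
  preserves rw s -> row_column R cl rw (s * g)%g = row_column R cl rw g.
Proof.
by move=> rs; apply: eq_bigr => t _; rewrite -mulgA (preservesMl _ rs).
Qed.

Lemma row_columnMr (R : pzRingType) (T : finType) (cl rw : T -> nat) s g :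
  preserves cl s ->
  row_column R cl rw (g * s)%g = (-1) ^+ s * row_column R cl rw g.
Proof.
move=> cs; rewrite /row_column [RHS]mulr_sumr [RHS](reindex_inj (mulgI s)) /=.
apply: eq_big => [t | t _]; first by rewrite (preservesMl _ cs).
by rewrite odd_permM signr_addb -mulrA signMsign mulgA.
Qed.

Lemma row_column_sym (R : pzRingType) (T : finType) (cl rw : T -> nat)
    (D : {set T}) : {in D &, forall x y, cl x = cl y} ->
  sym_on true D (row_column R cl rw).
Proof.
move=> eqD x y g xD yD neq_xy; rewrite row_columnMr ?odd_tperm ?neq_xy //.
by apply: preserves_tperm; apply: eqD.
Qed.

Lemma column_row_columnMr (R : pzRingType) (T : finType) (cl rw : T -> nat) s g :
  preserves cl s ->
  column_row_column R cl rw (g * s)%g = (-1) ^+ s * column_row_column R cl rw g.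
Proof.
move=> cs; rewrite /column_row_column mulr_sumr; apply: eq_bigr => t _.
rewrite mulgA row_columnMr //.
by case: (odd_perm s); case: (odd_perm t); rewrite ?expr1 ?expr0 ?mulN1r ?mul1r ?mulN1r.
Qed.

(** The form on polytabloids is symmetric.  This turns a relation between left
translates into one between right translates. *)
Lemma column_row_columnV (R : comPzRingType) (T : finType) (cl rw : T -> nat) g :
  column_row_column R cl rw g^-1%g = column_row_column R cl rw g.
Proof.
rewrite /column_row_column /row_column.
under eq_bigr => t _ do rewrite mulr_sumr.
under [in RHS]eq_bigr => t _ do rewrite mulr_sumr.
rewrite exchange_big [LHS](reindex_inj invg_inj) /=.
apply: eq_big => [t | t _]; first by rewrite preservesV.
rewrite (reindex_inj invg_inj) /=; apply: eq_big => [s | s _].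
  by rewrite preservesV.
rewrite !odd_permV mulrCA; congr (_ * (_ * _%:R)).
by rewrite -preservesV !invMg !invgK mulgA.
Qed.

Lemma card_column (T : finType) (m n : nat) (cl rw : T -> nat) j :
  near_rectangle m n cl rw -> (j <= n)%N -> #|[set x | cl x == j]| = m.
Proof.
move=> nr le_jn; pose f x := Ordinal (row_lt nr x).
rewrite -[RHS]card_ord -(@card_in_imset _ _ f [set x | cl x == j]).
  apply: eq_card => i; rewrite [RHS]inE; apply/imsetP.
  have [x [clx rwx]] := full_column nr le_jn (ltn_ord i).
  by exists x; [rewrite inE clx | apply: val_inj].
move=> x y; rewrite !inE => /eqP cx /eqP cy [eq_r].
by apply: (cell_inj nr); rewrite ?cx.
Qed.

Lemma adjoin_left_sum (R : comPzRingType) (T : finType) (b : bool) (D : {set T})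
    (c : T) (P : pred {perm T}) (e : {perm T} -> R) (f : {perm T} -> R) g :
  adjoin b D c (fun h => \sum_(t | P t) e t * f (t * h)%g) g =
    \sum_(t | P t) e t * adjoin b D c f (t * g)%g.
Proof.
under [RHS]eq_bigr => t _ do rewrite /adjoin mulrDr mulrCA mulr_sumr.
rewrite [RHS]big_split -[X in _ = _ + X]mulr_sumr exchange_big /=.
rewrite /adjoin; congr (_ + _ * _); apply: eq_bigr => q _.
by apply: eq_bigr => t _; rewrite mulgA.
Qed.

(** Adjoining c makes the function antisymmetric on m + 1 points.  Two of them come
from the same row, as there are m rows only, and exchanging those two does not
change a row-invariant function. *)
Lemma column_exchange (F : fieldType) (T : finType) (m n : nat)
    (cl rw : T -> nat) j c g :
  2%:R != 0 :> F -> near_rectangle m n cl rw -> (j <= n)%N -> cl c != j ->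
  adjoin true [set q | cl q == j] c (column_row_column F cl rw) g = 0.
Proof.
move=> two_neq0 nr le_jn neq_cj; set C := [set q | _].
have cC : c \notin C by rewrite inE.
have symC : sym_on true C (row_column F cl rw).
  by apply: row_column_sym => x y; rewrite !inE => /eqP-> /eqP->.
have row0 h : adjoin true C c (row_column F cl rw) h = 0.
  have [|x [y [xD yD neq_xy [eq_r]]]] := @pigeonhole_set _ 'I_m (c |: C) setT
      (fun y => Ordinal (row_lt nr ((h^-1)%g y))) (fun _ _ => in_setT _).
    by rewrite cardsT card_ord cardsU1 cC add1n (card_column nr le_jn).
  apply: eq_opp_eq0 => //; rewrite -[RHS]mulN1r -[-1]expr1.
  rewrite -(sym_on_adjoin symC cC _ xD yD) //.
  have -> : (h * tperm x y = tperm (h^-1 x) (h^-1 y) * h)%g.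
    by rewrite tpermM_swap !permKV.
  have rt := preserves_tperm eq_r.
  rewrite /adjoin (row_columnMl _ _ _ rt); congr (_ + _ * _); apply: eq_bigr => q _.
  by rewrite -mulgA (row_columnMl _ _ _ rt).
rewrite (adjoin_left_sum _ _ _ (preserves cl) (fun t => (-1) ^+ odd_perm t)).
by rewrite big1 // => t _; rewrite row0 mulr0.
Qed.

(** The sum is invariant under the permutations of the first row and x.  This set
has one element more than there are columns, so two of its elements are sent to
the same column, where the function is antisymmetric. *)
Lemma first_row_raise (F : fieldType) (T : finType) (m n : nat)
    (cl rw : T -> nat) x g :
  2%:R != 0 :> F -> near_rectangle m n cl rw -> rw x != 0%N ->
  row_column F cl rw g +
    \sum_(q | rw q == 0%N) row_column F cl rw (tperm q x * g)%g = 0.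
Proof.
move=> two_neq0 nr rwx; set A := [set q | rw q == 0%N].
have xA : x \notin A by rewrite inE.
pose f h := row_column F cl rw h^-1%g.
have symA : sym_on false A f.
  move=> y z h; rewrite !inE => /eqP ry /eqP rz _; rewrite expr0 mul1r /f.
  have rt : preserves rw (tperm y z) by apply: preserves_tperm; rewrite ry.
  by rewrite invMg tpermV (row_columnMl _ _ _ rt).
(* top y is the cell of the first row in the column of y. *)
have top_exists y : exists t, (cl t == cl y) && (rw t == 0%N).
  have [le_cn | gt_cn] := leqP (cl y) n; last by exists y; rewrite eqxx (short_column nr).
  have [t [ct rt]] := full_column nr le_cn (leq_ltn_trans (leq0n _) (row_lt nr y)).
  by exists t; rewrite ct rt !eqxx.
pose top y := xchoose (top_exists y).
have topP y : cl (top y) = cl y /\ rw (top y) = 0%N.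
  by case/andP: (xchooseP (top_exists y)) => /eqP ? /eqP.
have [y _||y [z [yA zA neq_yz eq_top]]] :=
    @pigeonhole_set _ _ (x |: A) A (fun y => top (g y)).
- by rewrite inE (topP _).2.
- by rewrite cardsU1 xA.
have eq_cl : cl (g y) = cl (g z).
  by rewrite -(topP (g y)).1 -(topP (g z)).1 eq_top.
have ct := preserves_tperm eq_cl.
have neq_g : g y != g z by rewrite (inj_eq perm_inj).
have -> : row_column F cl rw g +
    \sum_(q | rw q == 0%N) row_column F cl rw (tperm q x * g)%g =
    adjoin false A x f g^-1%g.
  rewrite /adjoin expr0 mul1r /f invgK; congr (_ + _).
  by apply: eq_big => [q | q _]; rewrite ?inE // invMg invgK tpermV.
apply: eq_opp_eq0 => //.
rewrite -{1}[adjoin _ _ _ _ _]mul1r -[X in X * _](expr0 (-1)).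
rewrite -(sym_on_adjoin symA xA _ yA zA) //.
have fE h : f (g^-1 * tperm y z * h)%g = - f (g^-1 * h)%g.
  rewrite /f !invMg invgK tpermV tpermM_swap mulgA (row_columnMr _ _ _ ct).
  by rewrite odd_tperm neq_g mulN1r.
rewrite /adjoin opprD -mulrN.
have := fE 1%g; rewrite !mulg1 => ->; congr (_ + _ * _).
by rewrite -[RHS]sumrN; apply: eq_bigr => q _; rewrite fE.
Qed.

Lemma column_reindex (F : fieldType) (T : finType) (cl : T -> nat)
    (c y z : T) (s : {perm T}) (f : {perm T} -> F) :
  preserves cl s -> s y = z ->
  \sum_(t | preserves cl t && ((t^-1)%g c == y)) (-1) ^+ t * f t =
    (-1) ^+ s * \sum_(t | preserves cl t && ((t^-1)%g c == z))
       (-1) ^+ t * f (s * t)%g.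
Proof.
move=> cs sy; rewrite (reindex_inj (mulgI s)) /= mulr_sumr.
apply: eq_big => [t | t _]; last by rewrite odd_permM signr_addb mulrA.
rewrite (preservesMl _ cs) invMg permM -(inj_eq (@perm_inj _ s)) permKV sy.
by rewrite eq_sym.
Qed.

(** This element of the Specht module lies in the radical of the form because l + m vanishes in F, where l is the number of
short columns.  Let y be the cell sent to c by a column permutation t.  If y is
the top cell of its column, each of the l + 1 terms equals S0.  For each of the
other m - 1 cells y, the raising relation into the first row replaces the short
columns by the tops of the full columns: the column of c contributes S0, and the
contribution of any other column cancels with itself. *)
Lemma short_exchange (F : fieldType) (T : finType) (m n : nat)
    (cl rw : T -> nat) c g :
  2%:R != 0 :> F -> near_rectangle m n cl rw ->
  (#|[set q | n < cl q]%N| + m)%:R = 0 :> F -> (cl c <= n)%N ->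
  adjoin false [set q | n < cl q]%N c (column_row_column F cl rw) g = 0.
Proof.
move=> two_neq0 nr char_dvd le_cn; set E := [set q | _].
have m_gt0 : (0 < m)%N by apply: leq_ltn_trans (row_lt nr c).
have [qC [cqC rqC]] := full_column nr le_cn m_gt0.
pose h := (g^-1)%g.
have -> : adjoin false E c (column_row_column F cl rw) g =
    column_row_column F cl rw h +
    \sum_(q in E) column_row_column F cl rw (tperm q c * h)%g.
  rewrite /adjoin expr0 mul1r -column_row_columnV; congr (_ + _).
  by apply: eq_bigr => q _; rewrite -column_row_columnV invMg tpermV.
rewrite /column_row_column.
have raise x u rx := @first_row_raise F T m n cl rw x u two_neq0 nr rx.
have rowM s u rs := @row_columnMl F T cl rw s u rs.
move: {g}(row_column F cl rw) h raise rowM => b h raise rowM.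
have -> : \sum_(t | preserves cl t) (-1) ^+ t * b (t * h)%g +
    \sum_(q in E) \sum_(t | preserves cl t) (-1) ^+ t * b (t * (tperm q c * h))%g =
  \sum_(t | preserves cl t) (-1) ^+ t *
     (b (t * h)%g + \sum_(q in E) b (t * (tperm q c * h))%g).
  rewrite exchange_big -big_split; apply: eq_bigr => t _.
  by rewrite [RHS]mulrDr mulr_sumr.
pose S0 := \sum_(t : {perm T} | preserves cl t && ((t^-1)%g c == qC)) (-1) ^+ t * b (t * h)%g.
rewrite (partition_big (fun t : {perm T} => (t^-1)%g c) (fun y => cl y == cl c)) /=; last first.
  by move=> t; rewrite -preservesV => /preservesP ->.
have fixE (t : {perm T}) q : preserves cl t -> q \in E -> (t^-1)%g q = q.
  rewrite inE -preservesV => /preservesP ct ltq.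
  by apply: (cell_inj nr); rewrite ?ct // !(short_column nr) ?ct.
have swapE (t : {perm T}) q y : preserves cl t -> (t^-1)%g c = y -> q \in E ->
    (t * (tperm q c * h) = tperm q y * (t * h))%g.
  move=> ct <- qE; rewrite mulgA [RHS]mulgA tpermM_swap permKV.
  by rewrite -{2}(fixE t q ct qE) permKV.
have Sy y : cl y = cl c -> y != qC ->
    \sum_(t : {perm T} | preserves cl t && ((t^-1)%g c == y)) (-1) ^+ t *
     (b (t * h)%g + \sum_(q in E) b (t * (tperm q c * h))%g) = S0.
  move=> cy neq_y; have ry : rw y != 0%N.
    by apply: contraNneq neq_y => ry; apply/eqP/(cell_inj nr); rewrite ?cy ?ry ?cqC.
  rewrite (eq_bigr (fun t : {perm T} => \sum_(q | (rw q == 0%N) && (cl q <= n)%N)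
       - ((-1) ^+ t * b (tperm q y * (t * h))%g))); last first.
    move=> t /andP[ct /eqP ty]; rewrite sumrN -mulr_sumr -mulrN; congr (_ * _).
    apply/eqP; rewrite -subr_eq0 opprK -addrA -[X in _ == X](raise y (t * h)%g ry).
    apply/eqP; congr (_ + _); rewrite [RHS](bigID (mem E)) /=; congr (_ + _).
      apply: eq_big => [q | q qE]; last by rewrite (swapE t q y).
      case: (boolP (q \in E)); rewrite ?andbF // inE => ltq.
      by rewrite (short_column nr) // eqxx.
    by apply: eq_bigl => q; rewrite inE leqNgt.
  rewrite exchange_big (bigD1 qC) /= ?rqC ?cqC ?eqxx // sumrN.
  rewrite (@column_reindex _ _ _ _ _ qC (tperm qC y)); last by rewrite tpermR.
  - rewrite odd_tperm eq_sym neq_y mulN1r opprK.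
    rewrite [X in _ + X]big1 ?addr0 => [|q /andP[/andP[/eqP rq leq] neq_q]].
      by apply: eq_bigr => t _; rewrite !mulgA tperm2 mul1g.
    rewrite sumrN; apply/eqP; rewrite oppr_eq0; apply/eqP.
    have neq_cq : cl q != cl c.
      by apply: contraNneq neq_q => cq; apply/eqP/(cell_inj nr); rewrite ?cq ?cqC ?rq.
    (* q' is the cell of the column of q in the row of y: transposing q and q'
       changes the sign of t, and amounts to a permutation of the row of y. *)
    have [q' [cq' rq']] := full_column nr leq (row_lt nr y).
    have neq_qq' : q != q' by apply: contraNneq ry => eq_q; rewrite -rq' -eq_q rq.
    have neq_col z : cl z = cl q -> z != y.
      by move=> cz; apply: contraNneq neq_cq => eq_z; rewrite -cz eq_z cy.
    have neq_qy := neq_col q erefl; have neq_q'y := neq_col q' cq'.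
    apply: eq_opp_eq0 => //.
    rewrite {1}(@column_reindex _ _ _ _ _ y (tperm q q')).
    + rewrite odd_tperm neq_qq' mulN1r; congr (- _); apply: eq_bigr => t _.
      have -> : (tperm q y * (tperm q q' * t * h) =
                 tperm y q' * (tperm q y * (t * h)))%g.
        by rewrite !mulgA [in RHS]tpermM_swap tpermR [tperm q y q']tpermD // eq_sym.
      by rewrite rowM //; apply: preserves_tperm.
    + by apply: preserves_tperm.
    by rewrite tpermD.
  by apply: preserves_tperm; rewrite cqC cy.
rewrite (bigD1 qC) ?cqC //= [X in _ + X](eq_bigr (fun _ => S0)); last first.
  by move=> y /andP[/eqP cy neq_y]; apply: Sy.
rewrite sumr_const.
have -> : #|(fun y => (cl y == cl c) && (y != qC))| = m.-1.
  rewrite -[in RHS](card_column nr le_cn) (cardsD1 qC) inE cqC eqxx /=.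
  by apply: eq_card => y; rewrite !inE andbC.
rewrite (eq_bigr (fun t : {perm T} => (-1) ^+ t * b (t * h)%g * (1 + #|E|%:R))).
  rewrite -mulr_suml -/S0 -[X in _ + X]mulr_natr -mulrDr nat1r -natrD addSnnS.
  by rewrite prednK // char_dvd mulr0.
move=> t /andP[ct /eqP tc]; rewrite -mulrA; congr (_ * _).
rewrite mulrDr mulr1 mulr_natr -sumr_const; congr (_ + _); apply: eq_bigr => q qE.
rewrite (swapE t q qC) // rowM //; apply: preserves_tperm.
by rewrite rqC (short_column nr) //; move: qE; rewrite inE.
Qed.

(** * Vanishing of the symmetrized matrix coefficient *)

(** A permutation of order p moves some point in a cycle of length p, too long for
a colour class. *)
Lemma card_preserves_prime (T : finType) (c : T -> nat) (p : nat) :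
  prime p -> (forall x, #|[set y | c y == c x]| < p)%N ->
  ~~ (p %| #|[set s | preserves c s]|)%N.
Proof.
move=> p_pr small; apply/negP => dvdp.
have gH : group_set [set s | preserves c s].
  apply/group_setP; split=> [|s t]; first by rewrite inE preserves1.
  by rewrite !inE => cs ct; rewrite preservesMl.
have [s sH ord_s] := @Cauchy _ p (Group gH) p_pr dvdp.
have [s1 | [x]] := set_0Vmem [set z | s z != z].
  have : s = 1%g.
    apply/permP => z; rewrite perm1; apply/eqP; apply: contraFT (in_set0 z).
    by move=> sz; rewrite -s1 inE.
  by move=> s_1; move: p_pr; rewrite -ord_s s_1 order1.
rewrite inE => sx; have cs : forall z, c (s z) = c z.
  by apply/preservesP; move: sH; rewrite inE.
have sub : porbit s x \subset [set y | c y == c x].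
  apply/subsetP => _ /porbitP[i ->]; rewrite inE; apply/eqP.
  elim: i => [|i IHi]; first by rewrite expg0 perm1.
  by rewrite expgSr permM cs.
have dvd_orb : (#|porbit s x| %| p)%N.
  by rewrite -ord_s porbit.unlock; exact: (dvdn_orbit 'P <[s]>%G x).
case/pred2P: ((primeP p_pr).2 _ dvd_orb) => [/eqP/cards1P[y orb1] | orb_p].
  case/eqP: sx; have := porbit_id s x; have := mem_porbit s 1 x.
  rewrite expg1.
  by rewrite orb1 !inE => /eqP-> /eqP.
by have := leq_ltn_trans (subset_leq_card sub) (small x); rewrite orb_p ltnn.
Qed.

(** Only the identity preserves both rows and columns: a polytabloid has squared
norm the order of the column stabilizer. *)
Lemma column_row_column1 (R : pzRingType) (T : finType) (m n : nat)
    (cl rw : T -> nat) :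
  near_rectangle m n cl rw ->
  column_row_column R cl rw 1%g = #|[set s | preserves cl s]|%:R.
Proof.
move=> nr; rewrite /column_row_column -sum1_card natr_sum.
apply: eq_big => [s | s cs]; first by rewrite inE.
rewrite mulg1 /row_column (bigD1 s^-1%g) ?preservesV //= mulgV preserves1 mulr1.
rewrite odd_permV big1 ?addr0 ?signMsign => [|t /andP[ct neq_t]].
  by rewrite -signr_addb addbb.
case: (boolP (preserves rw (s * t)%g)) => [/preservesP rst | _]; last by rewrite mulr0.
case/eqP: neq_t; apply: (mulgI s); rewrite mulgV; apply/permP => z.
rewrite perm1; apply: (cell_inj nr) => //; apply/preservesP.
by rewrite preservesMl.
Qed.

Definition vanishes (R : pzRingType) (m n r : nat) (w : word m n r)
    (a : 'S_r -> R) (g : 'S_r) : Prop :=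
  forall h, stab_sum w (fun u => a (u * g)%g) h = 0.

(** Let c carry the letter i, and suppose that g c lies outside Z.  The relation
expresses the translate at hand by those in which g c has been exchanged with a
point of Z.  If that point also carries i, the operator X_w maps the new
translate back to the old one, up to the sign in the relation; together these
terms give an invertible multiple of the old value.  The other terms have one
more point with letter i in Z.  The predicate Q keeps track of the letters that
have been placed before. *)
Lemma letter_exchange (F : fieldType) (m n r : nat) (w : word m n r)
    (a : 'S_r -> F) (i : 'I_(m + n)) (Z : {set 'I_r}) (Q : 'S_r -> Prop) :
  (forall t, (t <= #|Z|)%N -> t.+1%:R != 0 :> F) ->
  (forall c u, c \notin Z -> adjoin (odd_index i) Z c a u = 0) ->
  (forall x c (g : 'S_r), w x != i -> w c = i -> g x \in Z -> g c \notin Z -> Q g ->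
     Q (tperm x c * g)%g) ->
  (forall g : 'S_r, Q g -> (forall x, w x = i -> g x \in Z) -> vanishes w a g) ->
  forall g, Q g -> vanishes w a g.
Proof.
move=> unitZ relZ stabQ doneZ g.
have [N] := ubnP #|[set x | (w x == i) && (g x \notin Z)]|.
elim: N g => // N IHN g ltN Qg.
have [D0 | [c]] := set_0Vmem [set x | (w x == i) && (g x \notin Z)].
  apply: doneZ => // x wx; apply: contraFT (in_set0 x) => gx.
  by rewrite -D0 inE wx eqxx.
rewrite inE => /andP[/eqP wc gc] h.
pose A := [set x | g x \in Z].
have cA : c \notin A by rewrite inE.
have relA u : a (u * g)%g + (-1) ^+ odd_index i *
    \sum_(x in A) a (u * tperm x c * g)%g = 0.
  rewrite -[RHS](relZ (g c) (u * g)%g gc) /adjoin; congr (_ + _ * _).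
  rewrite [RHS](reindex_inj (@perm_inj _ g)) /=.
  by apply: eq_big => [x | x _]; rewrite ?inE // -!mulgA tpermM_swap.
have {relA} : stab_sum w (fun u => a (u * g)%g + (-1) ^+ odd_index i *
    \sum_(x in A) a (u * tperm x c * g)%g) h = 0.
  by rewrite /stab_sum big1 // => s _; rewrite relA mulr0.
rewrite (stab_sumD _ _ _ (fun u => a (u * g)%g) _
  (fun x u => a (u * tperm x c * g)%g)).
rewrite (bigID (fun x => w x == i)) /= [X in _ * (_ + X)]big1 ?addr0; last first.
  move=> x /andP[xA wx]; have gx : g x \in Z by rewrite inE in xA.
  have := IHN (tperm x c * g)%g; rewrite /vanishes.
  under [stab_sum _ _ h]eq_bigr => s _ do rewrite -mulgA.
  apply; last exact: stabQ.
  rewrite -ltnS; apply: leq_trans ltN; rewrite ltnS.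
  apply: proper_card; apply/properP; split.
    apply/subsetP => y; rewrite !inE permM => /andP[wy].
    by case: tpermP => [eq_y|->|_ _] //; [rewrite -eq_y wy in wx | rewrite gx | rewrite wy].
  by exists c; rewrite inE ?wc ?eqxx ?permM ?tpermR ?gx.
set A' := (X in \sum_(x | X x) _).
rewrite (eq_bigr (fun _ => (-1) ^+ odd_index i * stab_sum w (fun u => a (u * g)%g) h)).
  rewrite sumr_const -mulrnAr signMsign -mulrS -mulr_natl => /eqP.
  rewrite mulf_eq0 => /orP[|/eqP//]; rewrite (negPf (unitZ _ _)) //.
  apply: leq_trans (_ : #|A| <= _)%N.
    by apply: subset_leq_card; apply/subsetP => x /andP[].
  rewrite -(card_imset _ (@perm_inj _ g)); apply: subset_leq_card.
  by apply/subsetP => _ /imsetP[x xA ->]; rewrite inE in xA.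
move=> x /andP[xA /eqP wx]; rewrite -wx.
rewrite -(@stab_sum_tperm _ _ _ _ w (fun u => a (u * g)%g) h x c) ?wx //.
by apply: contraNneq cA => <-.
Qed.

Lemma letters_exchange (F : fieldType) (m n r : nat) (w : word m n r)
    (a : 'S_r -> F) (Z : 'I_(m + n) -> {set 'I_r}) (L : seq 'I_(m + n)) :
  (forall i t, i \in L -> (t <= #|Z i|)%N -> t.+1%:R != 0 :> F) ->
  (forall i c u, i \in L -> c \notin Z i -> adjoin (odd_index i) (Z i) c a u = 0) ->
  (forall i j x, i \in L -> j \in L -> i != j -> x \in Z i -> x \notin Z j) ->
  uniq L ->
  (forall g : 'S_r, (forall i x, i \in L -> w x = i -> g x \in Z i) ->
     vanishes w a g) ->
  forall g, vanishes w a g.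
Proof.
elim: L => [|i L IHL] unitZ relZ disjZ; first by move=> _ doneZ g; apply: doneZ.
rewrite cons_uniq => /andP[iL uniqL] doneZ; apply: IHL => //.
- by move=> j t jL; apply: unitZ; rewrite inE jL orbT.
- by move=> j c u jL; apply: relZ; rewrite inE jL orbT.
- by move=> j l x jL lL; apply: disjZ; rewrite inE ?jL ?lL orbT.
apply: (@letter_exchange _ _ _ _ w a i (Z i)
  (fun g => forall j x, j \in L -> w x = j -> g x \in Z j)).
- by move=> t; apply: unitZ; rewrite mem_head.
- by move=> c u; apply: relZ; rewrite mem_head.
- move=> x c g wx wc gx gc Qg j y jL wy; rewrite permM.
  have neq_ij : i != j by apply: contraNneq iL => ->.
  case: tpermP wy => [-> wxj | -> wcj | _ _ wyj]; last exact: Qg.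
    have := disjZ i j (g x) _ _ neq_ij gx; rewrite mem_head inE jL orbT.
    by rewrite (Qg j x) // => /(_ isT isT).
  by rewrite -wcj wc eqxx in neq_ij.
move=> g Qg ig; apply: doneZ => j x; rewrite inE => /predU1P[-> | jL]; first exact: ig.
exact: Qg.
Qed.

(** The letter 0 is placed in the short columns and the odd letter m + j in the full
column j. *)
Lemma column_row_column_killed (F : fieldType) (m n r : nat)
    (cl rw : 'I_r -> nat) (w : word m n r) g :
  2%:R != 0 :> F -> (0 < m)%N -> near_rectangle m n cl rw ->
  (#|[set q | n < cl q]%N| + m)%:R = 0 :> F ->
  (forall t, (t <= m)%N || (t <= #|[set q | n < cl q]%N|)%N -> t.+1%:R != 0 :> F) ->
  stab_sum w (column_row_column F cl rw) g = 0.
Proof.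
move=> two_neq0 m_gt0 nr char_dvd unit_le.
pose Z (i : 'I_(m + n)) := if odd_index i then [set x | cl x == i - m]%N
  else [set q | n < cl q]%N.
pose L := [seq i <- enum 'I_(m + n) | odd_index i || (i == 0 :> nat)].
have memL i : (i \in L) = odd_index i || (i == 0 :> nat).
  by rewrite mem_filter mem_enum andbT.
have lt_n (i : 'I_(m + n)) : odd_index i -> (i - m < n)%N.
  by rewrite /odd_index => le_mi; rewrite ltn_subLR.
suff /(_ 1%g g) : forall g, vanishes w (column_row_column F cl rw) g.
  by rewrite /stab_sum; under eq_bigr => h _ do rewrite mulg1.
apply: (@letters_exchange _ _ _ _ _ _ Z L).
- move=> i t _; rewrite /Z; case: ifP => oi le_t; apply: unit_le.
    by rewrite -(card_column nr (ltnW (lt_n i oi))) le_t.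
  by rewrite le_t orbT.
- move=> i c u _; rewrite /Z; case: ifP => oi; rewrite inE => cZ.
    exact: column_exchange nr (ltnW (lt_n i oi)) cZ.
  by apply: (short_exchange _ two_neq0 nr char_dvd); rewrite leqNgt.
- move=> i j x; rewrite !memL /Z; case: ifP => oi; case: ifP => oj //=;
    rewrite !inE.
  + move=> _ _ neq_ij /eqP->; move: oi oj neq_ij.
    by rewrite /odd_index -val_eqE /=; lia.
  + by move=> _ _ _ /eqP->; rewrite -leqNgt ltnW // lt_n.
  + by move=> _ _ _ lt_x; apply: contraTneq lt_x => ->; rewrite -leqNgt ltnW // lt_n.
  by move=> /eqP i0 /eqP j0; rewrite -val_eqE /= i0 j0.
- by rewrite filter_uniq ?enum_uniq.
move=> h satL u.
(* The even letters other than 0, the only ones left for column n. *)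
pose even_letters := [set i : 'I_(m + n) | (0 < i < m)%N].
have small : (#|even_letters| < m)%N.
  apply: (@leq_ltn_trans #|[set i : 'I_m | (0 < i)%N]|).
    rewrite -(card_imset _ (@lshift_inj m n)); apply: subset_leq_card.
    apply/subsetP => i; rewrite inE => /andP[i0 im].
    by apply/imsetP; exists (Ordinal im); [rewrite inE | apply: val_inj].
  rewrite -[X in (_ < X)%N]card_ord; apply: proper_card; apply/properP; split.
    exact/subsetP.
  by exists (Ordinal m_gt0); rewrite ?inE.
have evenA x : cl (h x) = n -> w x \in even_letters.
  move=> clx; rewrite inE lt0n ltnNge -negb_or orbC -memL.
  apply/negP => wxL; have := satL (w x) x wxL erefl; rewrite /Z; case: ifP => ow.
    by rewrite inE clx => /eqP eq_n; have := lt_n _ ow; rewrite -eq_n ltnn.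
  by rewrite inE clx ltnn.
have [x||y [z [yA zA neq_yz eq_w]]] :=
    @pigeonhole_set _ _ [set x | cl (h x) == n] even_letters w.
- by rewrite inE => /eqP; apply: evenA.
- rewrite -[#|[set x | _]|](card_imset _ (@perm_inj _ h)).
  rewrite (_ : _ @: _ = [set x | cl x == n]) ?(card_column nr) //.
  apply/setP => x; rewrite inE; apply/imsetP/idP => [[y] | clx].
    by rewrite inE => clx ->.
  by exists ((h^-1)%g x); rewrite ?inE permKV.
have wy : w y \in even_letters by apply: evenA; move: yA; rewrite inE => /eqP.
apply: eq_opp_eq0 => //.
have := stab_sum_tperm (fun u => column_row_column F cl rw (u * h)%g) u neq_yz eq_w.
have -> : odd_index (w y) = false.
  by move: wy; rewrite inE /odd_index => /andP[_]; rewrite ltnNge => /negbTE.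
have ct : preserves cl (tperm (h y) (h z)).
  by apply: preserves_tperm; move: yA zA; rewrite !inE => /eqP-> /eqP->.
rewrite expr0 mul1r => eq_S; rewrite -{1}eq_S /stab_sum -sumrN.
apply: eq_bigr => s _; rewrite -mulrN -[(_ * h)%g in LHS]mulgA tpermM_swap mulgA.
by rewrite (column_row_columnMr _ _ _ ct) odd_tperm (inj_eq perm_inj) neq_yz mulN1r.
Qed.

(** * Non-injectivity when p is at most m + n *)

Lemma Phi_not_injective (k : fieldType) (m n r : nat) (a : 'S_r -> k) s :
  a s != 0 -> (forall (w : word m n r) g, stab_sum w a g = 0) ->
  ~ injective (Phi k m n r).
Proof.
move=> as_neq0 /Phi_kernelP a0 inj.
have /inj/ffunP/(_ s^-1%g) : Phi k m n r [ffun s => a s^-1%g] = Phi k m n r 0.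
  by rewrite a0 linear0.
by rewrite !ffunE invgK => /eqP; rewrite (negPf as_neq0).
Qed.

Definition cell_column (m n : nat) (x : nat) : nat :=
  if (x < m * n.+1)%N then (x %/ m)%N else (n.+1 + (x - m * n.+1))%N.

Definition cell_row (m n : nat) (x : nat) : nat :=
  if (x < m * n.+1)%N then (x %% m)%N else 0%N.

Lemma near_rectangle_cells (m n l : nat) : (0 < m)%N ->
  near_rectangle m n (fun x : 'I_(m * n.+1 + l) => cell_column m n x)
    (fun x => cell_row m n x).
Proof.
move=> m_gt0.
have lt_div x : (x < m * n.+1)%N -> (x %/ m < n.+1)%N.
  by move=> ltx; rewrite ltn_divLR // mulnC.
split.
- move=> x y; rewrite /cell_column /cell_row => eq_c eq_r; apply: val_inj => /=.
  move: eq_c eq_r (lt_div x) (lt_div y).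
  case: (ltnP x _) => ltx; case: (ltnP y _) => lty; lia.
- by move=> x; rewrite /cell_row; case: ifP => // _; rewrite ltn_mod.
- move=> j i le_jn lt_im.
  have lt_x : (j * m + i < m * n.+1)%N by nia.
  exists (Ordinal (ltn_addr l lt_x)); rewrite /cell_column /cell_row /= lt_x.
  by rewrite divnMDl // divn_small // addn0 modnMDl modn_small.
by move=> x; rewrite /cell_column /cell_row; case: ifP => // ltx; have := lt_div x ltx; lia.
Qed.

Lemma card_short_columns (m n l : nat) : (0 < m)%N ->
  #|[set x : 'I_(m * n.+1 + l) | n < cell_column m n x]%N| = l.
Proof.
move=> m_gt0; rewrite -[RHS]card_ord -(card_imset _ (@rshift_inj (m * n.+1) l)).
apply: eq_card => x; rewrite inE; apply/idP/imsetP => [|[y _ ->]].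
  rewrite /cell_column; case: (ltnP x (m * n.+1)) => [ltx|lex _].
    have : (x %/ m < n.+1)%N by rewrite ltn_divLR // [(n.+1 * m)%N]mulnC.
    by rewrite ltnS leqNgt => /negPf->.
  have lt_y : (x - m * n.+1 < l)%N by rewrite ltn_subLR.
  by exists (Ordinal lt_y) => //; apply: val_inj; rewrite /= subnKC.
by rewrite /cell_column /=; case: ifP; lia.
Qed.

(** The integers inverted by the exchanges are at most m + 1 or p - m + 1, and both
bounds are less than p, the second because m > 1. *)
Lemma Phi_not_injective_near_rectangle (k : fieldType) (p m n : nat) :
  p \in [pchar k] -> (1 < m)%N -> (1 < n)%N -> (m.+1 < p)%N -> (n.+1 < p)%N ->
  (p <= m + n)%N -> ~ injective (Phi k m n (m * n.+1 + (p - m))).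
Proof.
move=> charp m_gt1 n_gt1 lt_mp lt_np le_p; set l := (p - m)%N.
have p_pr := pcharf_prime charp.
have unit_lt t : (0 < t < p)%N -> t%:R != 0 :> k.
  by case/andP=> t_gt0 lt_tp; rewrite -(dvdn_pcharf charp) gtnNdvd.
have m_gt0 : (0 < m)%N by apply: ltnW.
have nr := near_rectangle_cells n l m_gt0.
have two_neq0 : 2%:R != 0 :> k by apply: unit_lt; lia.
pose cl (x : 'I_(m * n.+1 + l)) := cell_column m n x.
pose rw (x : 'I_(m * n.+1 + l)) := cell_row m n x.
apply: (@Phi_not_injective _ _ _ _ (column_row_column k cl rw) 1%g).
  rewrite (column_row_column1 _ nr) -(dvdn_pcharf charp).
  apply: card_preserves_prime => // x.
  have [le_c | gt_c] := leqP (cell_column m n x) n.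
    by rewrite (card_column nr le_c) ltnW.
  apply: (@leq_ltn_trans 1%N); last exact: prime_gt1.
  rewrite -(cards1 x); apply: subset_leq_card; apply/subsetP => y.
  rewrite !inE => /eqP eq_c; apply/eqP/(cell_inj nr) => //.
  by rewrite !(short_column nr) ?eq_c.
move=> w g; apply: column_row_column_killed => //.
  rewrite card_short_columns // subnK; last by lia.
  by apply/eqP; rewrite -(dvdn_pcharf charp).
by move=> t; rewrite card_short_columns // => le_t; apply: unit_lt; lia.
Qed.

(** The terms are constant on the left cosets of Z. *)
Lemma sum_right_invariant (R : pzRingType) (T : finType) (P : pred {perm T})
    (Z : {group {perm T}}) (f : {perm T} -> R) :
  #|Z|%:R = 0 :> R ->
  (forall h z : {perm T}, z \in Z -> P (h * z)%g = P h) ->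
  (forall h z : {perm T}, z \in Z -> P h -> f (h * z)%g = f h) ->
  \sum_(h | P h) f h = 0.
Proof.
move=> Z0 PZ fZ; rewrite (partition_big (fun h => h *: Z)%g predT) //=.
apply: big1 => C _; case: (pickP [pred h | P h && (h *: Z == C)%g]) => [h0 | none].
  case/andP=> Ph0 /eqP <-.
  have memC h : P h && (h *: Z == h0 *: Z)%g = (h \in h0 *: Z)%g.
    apply/andP/idP => [[_ /eqP <-] | hC]; first exact: lcoset_refl.
    by rewrite (lcoset_eqP hC); case/lcosetP: hC => z zZ ->; rewrite PZ ?Ph0 ?eqxx.
  rewrite (eq_bigl _ _ memC) (eq_bigr (fun _ => f h0)).
    by rewrite sumr_const card_lcoset -mulr_natr Z0 mulr0.
  by move=> h /lcosetP[z zZ ->]; apply: fZ.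
by rewrite big_pred0 // => h; apply: none.
Qed.

(** The function is a multiplicative character of S_r: trivial if b is false, the
signature if b is true.  If a letter of the parity opposite to b occurs twice,
a transposition shows that X_w kills the character.  Otherwise some letter of
parity b occurs p times; eps and the character agree on the permutations of its
positions, a group of order divisible by p. *)
Lemma Phi_not_injective_character (k : fieldType) (p m n r : nat) (b : bool) :
  p \in [pchar k] -> (2 < p)%N ->
  ((if b then n else m) * p.-1 + (if b then m else n) < r)%N ->
  ~ injective (Phi k m n r).
Proof.
move=> charp p_gt2 lt_r.
have p_pr := pcharf_prime charp.
have two_neq0 : 2%:R != 0 :> k by rewrite -(dvdn_pcharf charp) gtnNdvd.
pose a (s : 'S_r) : k := (-1) ^+ (b && s).
have aM s t : a (s * t)%g = a s * a t.
  by rewrite /a odd_permM; case: (b) => /=; rewrite ?mulr1 // signr_addb.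
apply: (Phi_not_injective (a := a) (s := 1%g)) => [|w g]; first by rewrite /a signr_eq0.
have [/existsP[[x y] /and3P[neq_xy /eqP eq_w /eqP ow]] | ] := boolP [exists xy : 'I_r * 'I_r,
    [&& xy.1 != xy.2, w xy.1 == w xy.2 & odd_index (w xy.1) == ~~ b]].
  have := stab_sum_tperm a g neq_xy eq_w; rewrite ow.
  have -> : stab_sum w (fun h => a (h * tperm x y)%g) g = (-1) ^+ b * stab_sum w a g.
    rewrite /stab_sum mulr_sumr; apply: eq_bigr => h _.
    by rewrite aM [a (tperm x y)]/a odd_tperm neq_xy andbT [a _ * _]mulrC mulrCA.
  move=> eq_S; apply: eq_opp_eq0 => //; move: eq_S.
  by case: (b) => /=; rewrite ?expr0 ?expr1 ?mulN1r ?mul1r.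
move/existsPn=> inj_w.
have [i /andP[/eqP oi lti]] : exists i, (odd_index i == b) && (p <= #|[set x | w x == i]|)%N.
  apply/existsP; apply: contraLR lt_r => /existsPn small; rewrite -leqNgt.
  rewrite -[X in (X <= _)%N]card_ord -sum1_card.
  rewrite (partition_big w predT) //= big_split_ord /=.
  have le1 j : odd_index j != b -> (#|[set x | w x == j]| <= 1)%N.
    move=> oj; apply/card_le1_eqP => x y; rewrite !inE => /eqP wx /eqP wy.
    apply/eqP; have := inj_w (x, y); rewrite /= wx wy eqxx /=.
    by case: eqVneq => //= _; move: oj; case: odd_index; case: (b).
  have le_p j : odd_index j = b -> (#|[set x | w x == j]| <= p.-1)%N.
    move=> oj; have := small j; rewrite oj eqxx /= -ltnNge.
    by rewrite -{1}(prednK (prime_gt0 p_pr)) ltnS.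
  rewrite (eq_bigr (fun j => #|[set x | w x == lshift n j]|)); last first.
    by move=> j _; rewrite -sum1_card; apply: eq_bigl => x; rewrite inE.
  rewrite [X in (_ + X <= _)%N](eq_bigr (fun j => #|[set x | w x == rshift m j]|)); last first.
    by move=> j _; rewrite -sum1_card; apply: eq_bigl => x; rewrite inE.
  have ol j : odd_index (lshift n j : 'I_(m + n)) = false.
    by rewrite /odd_index /= leqNgt ltn_ord.
  have or j : odd_index (rshift m j : 'I_(m + n)) = true by rewrite /odd_index leq_addr.
  apply: (@leq_trans (m * (if b then 1 else p.-1) + n * (if b then p.-1 else 1))%N).
    apply: leq_add; rewrite -[X in (_ <= X * _)%N]card_ord -sum_nat_const;
      apply: leq_sum => j _.
      by case: ifP => eq_b; [apply: le1 | apply: le_p]; rewrite ol eq_b.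
    by case: ifP => eq_b; [apply: le_p | apply: le1]; rewrite or eq_b.
  by case: (b); lia.
pose A := [set x | w x == i].
have Awz z : perm_on A z -> perm_word z w = w.
  move=> Az; apply/eqP/perm_word_id => x.
  have [xA | xA] := boolP (x \in A); last by rewrite (out_perm Az xA).
  have := xA; rewrite -(perm_closed x Az) inE => /eqP->.
  by move: xA; rewrite inE => /eqP.
have triv_z z : perm_on A z -> (-1) ^+ odd_inversions z w * a z = 1.
  move/perm_onP; move: z.
  apply: (@preserving_perm_ind _ _ (fun x => if x \in A then None else Some x)
    (fun z => (-1) ^+ odd_inversions z w * a z = 1)).
    by rewrite /a -signr_odd odd_inversions1 odd_perm1 andbF mul1r.
  move=> x y z neq_xy eq_c _ IHz.
  have [xA yA] : x \in A /\ y \in A.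
    move: eq_c; case: ifP => // _; case: ifP => // _ [eq_xy].
    by rewrite eq_xy eqxx in neq_xy.
  have wxy : w x = w y by move: xA yA; rewrite !inE => /eqP-> /eqP->.
  have tw : perm_word (tperm x y) w = w.
    by apply/eqP/perm_word_id => u; case: tpermP => // ->.
  have wi : w x = i by move: xA; rewrite inE => /eqP.
  rewrite (signr_odd_add _ (odd_inversionsM (tperm x y) z w)) tw aM mulrACA IHz mulr1.
  rewrite -signr_odd odd_inversions_tperm // wi oi /a odd_tperm neq_xy andbT.
  by rewrite -signr_addb addbb.
rewrite /stab_sum; apply: (@sum_right_invariant _ _ (fun h => perm_word h w == w)
  (Sym_group A) (fun h => (-1) ^+ odd_inversions h w * a (g * h)%g)).
- by rewrite card_Sym; apply/eqP; rewrite -(dvdn_pcharf charp) dvdn_fact // prime_gt0.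
- move=> h z; rewrite inE => /Awz wz.
  by rewrite perm_wordM -[X in (_ == X) = _]wz (inj_eq (can_inj (perm_wordK _))).
move=> h z; rewrite inE => Az /eqP hw.
rewrite /= (signr_odd_add _ (odd_inversionsM h z w)) hw mulgA [a (_ * z)%g]aM mulrACA.
by rewrite triv_z ?mulr1.
Qed.

Theorem theorem2 (k : fieldType) (p : nat) (charkp : p \in [pchar k])
    (p_gt2 : (2 < p)%N) (m n : nat) :
  (forall r : nat, (r_p k m n < r)%N -> (r <= m + n + m * n)%N ->
     ~ injective (Phi k m n r) /\ ~ Phi_surjective k m n r) /\
  ((forall r : nat, (1 <= r)%N -> Phi_surjective k m n r) ->
     (m * n)%N = 0%N \/ (m + n < p)%N).
Proof.
have two_neq0 : 2%:R != 0 :> k by rewrite -(dvdn_pcharf charkp) gtnNdvd.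
have surj_inj r : (r <= m + n + m * n)%N ->
    Phi_surjective k m n r -> injective (Phi k m n r).
  by move=> le_r; apply: Phi_surjective_injective => //; nia.
split=> [r lt_r le_r | surj].
  have ninj : ~ injective (Phi k m n r) by rewrite r_pP leqNgt lt_r.
  by split=> // /surj_inj-/(_ le_r).
case: (posnP (m * n)) => [-> | mn_gt0]; first by left.
right; rewrite ltnNge; apply/negP => le_p.
move: mn_gt0; rewrite muln_gt0 => /andP[m_gt0 n_gt0].
suff [r [r_gt0 le_r ninj]] : exists r, [/\ (0 < r)%N, (r <= m + n + m * n)%N &
    ~ injective (Phi k m n r)].
  by apply: ninj; apply: surj_inj => //; apply: surj.
(* When p <= n + 1, the degree m(p - 1) + n + 1 is at most mn + m + n as m > 0. *)
have [le_pn | lt_np] := leqP p n.+1.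
  exists (m * p.-1 + n).+1; split=> //; first by nia.
  by apply: (Phi_not_injective_character (b := false) charkp).
have [le_pm | lt_mp] := leqP p m.+1.
  exists (n * p.-1 + m).+1; split=> //; first by nia.
  by apply: (Phi_not_injective_character (b := true) charkp).
exists (m * n.+1 + (p - m))%N; split; [lia | nia |].
by apply: Phi_not_injective_near_rectangle => //; lia.
Qed.
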